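(* Let $\mathcal{G}$ be a metric graph which is hyperbolic relative to a family $\mathcal{H}=\{H_c\mid c\in\mathcal{C}\}$ of complete connected subgraphs. If there is a number $\delta>0$ such that each of the graphs $H_c$ ($c\in\mathcal{C}$), equipped with its intrinsic path metric, is $\delta$-hyperbolic, then $\mathcal{G}$ is hyperbolic (in the sense of Gromov). Moreover, the subgraphs $H_c$ ($c\in\mathcal{C}$) are uniformly quasi-convex in $\mathcal{G}$, i.e. there is a number $k>0$ such that every $H_c$ is $k$-quasi-convex in $\mathcal{G}$.
   Context: A metric graph is a connected graph, not necessarily locally finite, with all edges of length one, equipped with the path metric. The index set $\mathcal{C}$ is countable, finite or empty. A complete subgraph is a full subgraph: it contains every edge of the ambient graph joining two of its vertices. Each $H_c$ carries its intrinsic path metric. Electrification: the $\mathcal{H}$-electrification $\mathcal{EG}$ of $\mathcal{G}$ is the metric graph obtained from $\mathcal{G}$ by adding for every $c\in\mathcal{C}$ one new vertex $v_c$, which is connected to each vertex of $H_c$ by an edge of length one and is not connected to any other vertex. Paths: all parametrized paths in $\mathcal{G}$ or $\mathcal{EG}$ are simplicial: the image of each integer is a vertex, and the image of each interval $[k,k+1]$ with $k\in\mathbb{Z}$ is an edge or a single vertex. A simplicial path $\gamma$ in $\mathcal{EG}$ is efficient if for every $c\in\mathcal{C}$ we have $\gamma(k)=v_c$ for at most one $k$. An $L$-quasi-geodesic is a path $\gamma$ with $|s-t|/L-L\le d(\gamma(s),\gamma(t))\le L|s-t|+L$ for all $s,t$ in its domain. Bounded penetration: $\mathcal{H}$ has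 the bounded penetration property if for every $L>0$ there is a number $p(L)>0$ with the following property. Let $\gamma$ be an efficient $L$-quasi-geodesic in $\mathcal{EG}$, let $c\in\mathcal{C}$ and let $k\in\mathbb{Z}$ be such that $\gamma(k)=v_c$. If the distance in $H_c$ between $\gamma(k-1)$ and $\gamma(k+1)$ is at least $p(L)$, then every efficient $L$-quasi-geodesic $\gamma'$ in $\mathcal{EG}$ with the same endpoints as $\gamma$ passes through $v_c$; moreover, if $\gamma'(k')=v_c$, then the distance in $H_c$ between $\gamma(k-1)$ and $\gamma'(k'-1)$ and the distance in $H_c$ between $\gamma(k+1)$ and $\gamma'(k'+1)$ are at most $p(L)$. Relative hyperbolicity: $\mathcal{G}$ is hyperbolic relative to $\mathcal{H}$ if $\mathcal{EG}$ is hyperbolic in the sense of Gromov and $\mathcal{H}$ has the bounded penetration property. Quasi-convexity: a subset $Z$ of $\mathcal{G}$ is $k$-quasi-convex if any geodesic in $\mathcal{G}$ with both endpoints in $Z$ is contained in the $k$-neighborhood of $Z$. *)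

(* Defs.v *)
From Stdlib Require Import Reals ZArith.
From Coquelicot Require Import Coquelicot.

Open Scope R_scope.

(** * Graphs and their geometric realizations *)

(** Loops and multiple edges are allowed.  Edges are unoriented: [src] and
    [tgt] only fix a parametrization of each closed edge by [0, 1]. *)
Record graph := Graph {
  vert : Type;
  edge : Type;
  src : edge -> vert;
  tgt : edge -> vert
}.

Arguments src {_} _.
Arguments tgt {_} _.

(** Points of the realization: vertices, and interior points of edges, so that
    no identification at the ends of the edges is needed. *)
Inductive point (G : graph) : Type :=
| pvert (v : vert G)
| pedge (e : edge G) (t : R) (ht : 0 < t < 1).

Arguments pvert {_} _.
Arguments pedge {_} _ _ _.

(** [at_pos e t x]: [x] has coordinate [t] on the closed edge [e]; if [e] is a
    loop, its base vertex has both coordinates 0 and 1. *)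
Inductive at_pos {G : graph} (e : edge G) : R -> point G -> Prop :=
| at_src : at_pos e 0 (pvert (src e))
| at_tgt : at_pos e 1 (pvert (tgt e))
| at_int : forall (t : R) (ht : 0 < t < 1), at_pos e t (pedge e t ht).

Definition on_edge {G : graph} (e : edge G) (x : point G) : Prop :=
  exists t, at_pos e t x.

(** [walk x y l]: there is a concatenation of finitely many segments, each
    contained in one closed edge, of total length [l] from [x] to [y]. *)
Inductive walk {G : graph} : point G -> point G -> R -> Prop :=
| walk_nil : forall x, walk x x 0
| walk_cons : forall e s t x y z l,
    at_pos e s x -> at_pos e t y -> walk y z l ->
    walk x z (Rabs (s - t) + l).

Definition connected (G : graph) : Prop :=
  inhabited (point G) /\ forall x y : point G, exists l, walk x y l.

(** The path metric with all edges of length one; only meaningful for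
    connected graphs (points not joined by a walk get the value 0). *)
Definition dist {G : graph} (x y : point G) : R :=
  real (Glb_Rbar (walk x y)).

(** * Hyperbolicity and quasi-convexity *)

Definition gromov_product {G : graph} (w x y : point G) : R :=
  (dist x w + dist y w - dist x y) / 2.

Definition delta_hyperbolic (delta : R) (G : graph) : Prop :=
  forall w x y z : point G,
    Rmin (gromov_product w x y) (gromov_product w y z) - delta
      <= gromov_product w x z.

Definition hyperbolic (G : graph) : Prop :=
  exists delta, 0 < delta /\ delta_hyperbolic delta G.

Definition geodesic {G : graph} (l : R) (g : R -> point G) : Prop :=
  0 <= l /\
  forall s t, 0 <= s <= l -> 0 <= t <= l -> dist (g s) (g t) = Rabs (s - t).

Definition quasi_convex {G : graph} (k : R) (Z : point G -> Prop) : Prop :=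
  forall (l : R) (g : R -> point G),
    geodesic l g -> Z (g 0) -> Z (g l) ->
    forall t, 0 <= t <= l -> exists z, Z z /\ dist (g t) z <= k.

(** * Complete subgraphs and electrification *)

(** A complete subgraph is determined by its set of vertices. *)
Definition full_subgraph (G : graph) (H : vert G -> Prop) : graph :=
  {| vert := {v : vert G | H v};
     edge := {e : edge G | H (src e) /\ H (tgt e)};
     src := fun e => exist H (src (proj1_sig e)) (proj1 (proj2_sig e));
     tgt := fun e => exist H (tgt (proj1_sig e)) (proj2 (proj2_sig e)) |}.

Definition subgraph_points {G : graph} (H : vert G -> Prop) (x : point G) : Prop :=
  match x with
  | pvert v => H v
  | pedge e _ _ => H (src e) /\ H (tgt e)
  end.

Definition electrification (G : graph) (C : Type) (H : C -> vert G -> Prop) : graph :=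
  {| vert := vert G + C;
     edge := edge G + {q : C * vert G | H (fst q) (snd q)};
     src := fun e => match e with
                     | inl e => inl (src e)
                     | inr q => inr (fst (proj1_sig q))
                     end;
     tgt := fun e => match e with
                     | inl e => inl (tgt e)
                     | inr q => inl (snd (proj1_sig q))
                     end |}.

Definition cone_point {G : graph} {C : Type} (H : C -> vert G -> Prop) (c : C) :
    point (electrification G C H) :=
  @pvert (electrification G C H) (inr c).

Definition base_vertex {G : graph} {C : Type} (H : C -> vert G -> Prop) (v : vert G) :
    point (electrification G C H) :=
  @pvert (electrification G C H) (inl v).

(** The distance in [H c], for vertices of [H c]. *)
Definition sub_dist {G : graph} {C : Type} (H : C -> vert G -> Prop) (c : C)
    (x y : {v : vert G | H c v}) : R :=
  @dist (full_subgraph G (H c)) (@pvert (full_subgraph G (H c)) x)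
                                (@pvert (full_subgraph G (H c)) y).

(** * Simplicial paths and bounded penetration *)

(** Paths are defined on intervals [a, b] with integer endpoints; the values of
    [g] outside [a, b] are irrelevant. *)
Definition continuous_path {G : graph} (a b : Z) (g : R -> point G) : Prop :=
  forall t, IZR a <= t <= IZR b -> forall eps, 0 < eps ->
  exists eta, 0 < eta /\
    forall s, IZR a <= s <= IZR b -> Rabs (s - t) < eta -> dist (g s) (g t) < eps.

Definition simplicial_path {G : graph} (a b : Z) (g : R -> point G) : Prop :=
  (a <= b)%Z /\
  continuous_path a b g /\
  (forall k : Z, (a <= k <= b)%Z -> exists v, g (IZR k) = pvert v) /\
  (forall k : Z, (a <= k < b)%Z ->
     (exists e, forall x,
        (exists t, IZR k <= t <= IZR (k + 1) /\ g t = x) <-> on_edge e x) \/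
     (exists v, forall t, IZR k <= t <= IZR (k + 1) -> g t = pvert v)).

Definition quasi_geodesic {G : graph} (L : R) (a b : Z) (g : R -> point G) : Prop :=
  forall s t, IZR a <= s <= IZR b -> IZR a <= t <= IZR b ->
    Rabs (s - t) / L - L <= dist (g s) (g t) <= L * Rabs (s - t) + L.

Definition efficient {G : graph} {C : Type} (H : C -> vert G -> Prop)
    (a b : Z) (g : R -> point (electrification G C H)) : Prop :=
  forall (c : C) (k k' : Z), (a <= k <= b)%Z -> (a <= k' <= b)%Z ->
    g (IZR k) = cone_point H c -> g (IZR k') = cone_point H c -> k = k'.

Definition efficient_quasi_geodesic {G : graph} {C : Type} (H : C -> vert G -> Prop)
    (L : R) (a b : Z) (g : R -> point (electrification G C H)) : Prop :=
  simplicial_path a b g /\ efficient H a b g /\ quasi_geodesic L a b g.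

(** By efficiency the neighbours [g (k-1)], [g (k+1)] of a passage of an
    efficient path through the cone point of [c] are vertices of [H c]; the
    variables [x], [y], [x'], [y'] name them as such.  As [g] and [g'] have the
    same endpoints, [a < k < b] implies [a' < k' < b']. *)
Definition bounded_penetration (G : graph) (C : Type) (H : C -> vert G -> Prop) : Prop :=
  forall L, 0 < L -> exists p, 0 < p /\
  forall (a b : Z) (g : R -> point (electrification G C H)),
    efficient_quasi_geodesic H L a b g ->
  forall (c : C) (k : Z) (x y : {v : vert G | H c v}),
    (a < k < b)%Z ->
    g (IZR k) = cone_point H c ->
    g (IZR (k - 1)) = base_vertex H (proj1_sig x) ->
    g (IZR (k + 1)) = base_vertex H (proj1_sig y) ->
    p <= sub_dist H c x y ->
  forall (a' b' : Z) (g' : R -> point (electrification G C H)),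
    efficient_quasi_geodesic H L a' b' g' ->
    g' (IZR a') = g (IZR a) -> g' (IZR b') = g (IZR b) ->
    (exists t, IZR a' <= t <= IZR b' /\ g' t = cone_point H c) /\
    (forall (k' : Z) (x' y' : {v : vert G | H c v}),
       (a' <= k' <= b')%Z ->
       g' (IZR k') = cone_point H c ->
       g' (IZR (k' - 1)) = base_vertex H (proj1_sig x') ->
       g' (IZR (k' + 1)) = base_vertex H (proj1_sig y') ->
       sub_dist H c x x' <= p /\ sub_dist H c y y' <= p).

Definition relatively_hyperbolic (G : graph) (C : Type) (H : C -> vert G -> Prop) : Prop :=
  hyperbolic (electrification G C H) /\ bounded_penetration G C H.

(* Main.v *)
From Pilot Require Import Defs.
From Stdlib Require Import Reals ZArith Lra Lia Arith Relations.
From Stdlib Require Import Classical ClassicalEpsilon ProofIrrelevance.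
From Coquelicot Require Import Coquelicot.
(* [dist] is the path metric of a graph, not the distance of a [Metric_Space]. *)
Import Pilot.Defs.

(** Everything is done on vertices, with integer distances; only the two ends of
    the argument, the hypotheses and the conclusion, speak of real paths.

    To two vertices [x], [y] of the graph is attached the set [enlarged x y]: the
    vertices on geodesics from [x] to [y] in the electrification, together with,
    for every passage [a, cone c, b] of such a geodesic through a cone point, the
    vertices on geodesics of [H c] from [a] to [b].  These sets are coarsely
    connected, they are small when [x] and [y] are adjacent, and the three sets of
    a triangle form a uniformly thin triangle ([enlarged_thin]).  For any family
    of sets with these properties ([thin_family]) a halving argument shows that
    the sets lie near the intervals between their endpoints
    ([family_near_interval]).  Thinness then gives the four-point inequality
    ([thin_family_four_point]), and any vertex that is nearly between [x] and [y]
    is close to the set of [x] and [y] ([family_product]).  The latter implies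
    quasi-convexity, since for [x], [y] in [H c] the set [enlarged x y] stays near
    [H c] ([enlarged_near_member]).

    Thinness is where bounded penetration enters.  Let [w] be a vertex nearest to
    [z] on a geodesic from [x] to [y] of the electrification.  Following the
    geodesic from [x] to [w] and then a geodesic from [w] to [z] is a
    quasi-geodesic with multiplicative constant 3 ([quasi_path_nearest]), hence
    injective, hence efficient.  By hyperbolicity it stays near a geodesic from
    [x] to [z] ([geodesic_projection], [near_interval]), so it remains to turn
    closeness in the electrification into closeness in the graph.  Let [t] be a
    shortest path from the geodesic to a vertex [u] of a quasi-path.  If [t]
    crossed a cone point deeply, then [t], preceded by either half of the
    geodesic, would be a quasi-path to [u] crossing it deeply as well; by bounded
    penetration both the part of the quasi-path before [u] and the part after [u]
    would visit that cone point, against injectivity ([no_common_deep_passage]).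
    So [t] has only shallow passages, and is short in the graph
    ([quasi_vertex_near]).  For deep passages of the quasi-path itself, bounded
    penetration and the hyperbolicity of [H c] are used directly
    ([quasi_passage_near]); when [w] is a cone point, the three passages through
    it span a triangle in [H c], which is thin. *)

Set Bullet Behavior "Strict Subproofs".
Local Open Scope nat_scope.

(** * Hyperbolicity of integer-valued geodesic metrics *)

(** The metric of the vertices of a connected graph; [gm_split] says that
    geodesics exist. *)
Record geodesic_metric {V : Type} (d : V -> V -> nat) : Prop := {
  gm_refl : forall x, d x x = 0;
  gm_eq : forall x y, d x y = 0 -> x = y;
  gm_sym : forall x y, d x y = d y x;
  gm_tri : forall x y z, d x z <= d x y + d y z;
  gm_split : forall x y i, i <= d x y ->
    exists z, d x z = i /\ d z y = d x y - i
}.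

Definition between {V : Type} (d : V -> V -> nat) (x z y : V) : Prop :=
  d x z + d z y = d x y.

(** Gromov's condition on products, multiplied by 2 and free of subtraction. *)
Definition four_point {V : Type} (K : nat) (d : V -> V -> nat) : Prop :=
  forall w x y z,
    d x z + d y w <= d x y + d z w + K \/ d x z + d y w <= d y z + d x w + K.

Definition geodesic_path {V : Type} (d : V -> V -> nat) (n : nat) (a : nat -> V) : Prop :=
  forall i j, i <= j <= n -> d (a i) (a j) = j - i.

Section Metric.

Context {V : Type} {d : V -> V -> nat} (M : geodesic_metric d).

Lemma between_sym x z y : between d x z y -> between d y z x.
Proof.
  unfold between; intros h.
  rewrite (gm_sym d M y z), (gm_sym d M z x), (gm_sym d M y x); lia.
Qed.

(** Let [v] be the point of an interval from [x] to [z] at distance [d x u] from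
    [x], or [z] if the interval is shorter.  In the four-point inequality the sum
    [d x z + d u v] is compared with [d x u + d v z], which is [d x z], and with
    [d u z + d x v], which is at most [d x z + r]. *)
Lemma near_interval K x u z r :
  four_point K d -> d x u + d u z <= d x z + r ->
  exists v, between d x v z /\ d u v <= r + K.
Proof.
  intros F h. unfold between.
  destruct (le_lt_dec (d x u) (d x z)) as [l|l].
  - destruct (gm_split d M x z (d x u) l) as [v [h1 h2]].
    exists v; split; [lia|].
    pose proof (gm_sym d M z v).
    destruct (F v x u z); lia.
  - exists z; rewrite (gm_refl d M z); lia.
Qed.

(** Intervals form thin triangles: for [u] between [a] and [b], the four-point
    inequality with the third vertex [e] says that [u] is nearly between [a] and
    [e] or nearly between [b] and [e], and [near_interval] applies. *)
Lemma interval_triangle K a u b e :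
  four_point K d -> between d a u b ->
  exists v, d u v <= 2 * K /\ (between d a v e \/ between d b v e).
Proof.
  unfold between at 1; intros F h.
  pose proof (gm_sym d M e b). pose proof (gm_sym d M u b).
  destruct (F e a u b) as [q|q].
  - destruct (near_interval K b u e K F) as [v [h1 h2]]; [lia|].
    exists v; split; [lia|auto].
  - destruct (near_interval K a u e K F) as [v [h1 h2]]; [lia|].
    exists v; split; [lia|auto].
Qed.

(** A nearest point projection nearly lies on the way.  Let [s] be the excess to
    be bounded.  The point of the path at distance [s / 2] from [a m] is no closer
    to [z] than [a m]; with the four-point inequality this forces [s / 2 <= K]. *)
Lemma geodesic_projection K m a z :
  four_point K d -> geodesic_path d m a ->
  (forall i, i <= m -> d (a m) z <= d (a i) z) ->
  d (a 0) (a m) + d (a m) z <= d (a 0) z + 2 * K + 1.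
Proof.
  intros F ga near.
  pose proof (ga 0 m ltac:(lia)) as h0.
  pose proof (gm_tri d M (a 0) (a m) z) as t1.
  pose proof (gm_tri d M (a m) (a 0) z) as t2.
  rewrite (gm_sym d M (a m) (a 0)) in t2.
  set (s := d (a 0) (a m) + d (a m) z - d (a 0) z).
  pose proof (Nat.div_mod s 2 ltac:(lia)) as e.
  pose proof (Nat.mod_upper_bound s 2 ltac:(lia)).
  set (i := s / 2) in *.
  assert (i <= m) by lia.
  pose proof (ga 0 (m - i) ltac:(lia)) as g1.
  pose proof (ga (m - i) m ltac:(lia)) as g2.
  pose proof (near (m - i) ltac:(lia)).
  pose proof (gm_sym d M (a (m - i)) (a m)).
  pose proof (gm_sym d M (a (m - i)) (a 0)).
  pose proof (gm_sym d M (a (m - i)) z).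
  pose proof (gm_sym d M (a m) z).
  destruct (F (a (m - i)) (a 0) z (a m)); lia.
Qed.

Lemma geodesic_path_exists x y :
  exists a, geodesic_path d (d x y) a /\ a 0 = x /\ a (d x y) = y.
Proof.
  remember (d x y) as n eqn:h; symmetry in h.
  revert x h; induction n as [|n IH]; intros x h.
  - apply (gm_eq d M) in h; subst y.
    exists (fun _ => x); repeat split.
    intros i j hij. rewrite (gm_refl d M); lia.
  - destruct (gm_split d M x y 1 ltac:(lia)) as [z [h1 h2]].
    destruct (IH z ltac:(lia)) as [a [ga [a0 an]]].
    exists (fun i => match i with 0 => x | S i => a i end); repeat split; auto.
    intros [|i] [|j] hij; try (rewrite (gm_refl d M); lia); try lia.
    + pose proof (ga 0 j ltac:(lia)) as g1. pose proof (ga j n ltac:(lia)) as g2.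
      rewrite a0 in g1. rewrite an in g2.
      pose proof (gm_tri d M x z (a j)). pose proof (gm_tri d M x (a j) y). lia.
    + rewrite ga; lia.
Qed.

Definition concat (m : nat) (a b : nat -> V) (i : nat) : V :=
  if i <=? m then a i else b (i - m).

Lemma concat_l m a b i : i <= m -> concat m a b i = a i.
Proof. intros h; unfold concat. apply Nat.leb_le in h; now rewrite h. Qed.

Lemma concat_r m a b i : a m = b 0 -> concat m a b (m + i) = b i.
Proof.
  intros h; unfold concat. destruct (Nat.leb_spec (m + i) m).
  - replace i with 0 by lia. now rewrite Nat.add_0_r.
  - f_equal; lia.
Qed.

Lemma geodesic_path_concat m l a b :
  geodesic_path d m a -> geodesic_path d l b -> a m = b 0 ->
  d (a 0) (b l) = m + l -> geodesic_path d (m + l) (concat m a b).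
Proof.
  intros ga gb ab h i j hij.
  destruct (le_lt_dec j m) as [jm|jm].
  { rewrite !concat_l by lia. apply ga; lia. }
  replace j with (m + (j - m)) at 1 by lia. rewrite (concat_r m a b (j - m) ab).
  destruct (le_lt_dec i m) as [im|im].
  - rewrite concat_l by lia.
    pose proof (ga 0 i ltac:(lia)). pose proof (ga i m ltac:(lia)) as g1.
    pose proof (gb 0 (j - m) ltac:(lia)) as g2. pose proof (gb (j - m) l ltac:(lia)).
    rewrite <- ab in g2.
    pose proof (gm_tri d M (a i) (a m) (b (j - m))).
    pose proof (gm_tri d M (a 0) (a i) (b l)).
    pose proof (gm_tri d M (a i) (b (j - m)) (b l)). lia.
  - replace i with (m + (i - m)) at 1 by lia. rewrite (concat_r m a b (i - m) ab).
    rewrite gb; lia.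
Qed.

(** The discrete efficient quasi-geodesics.  Without an additive constant such a
    path is injective, so efficiency needs no separate treatment; the factor 3 is
    the one produced by [quasi_path_nearest]. *)
Definition quasi_path (n : nat) (a : nat -> V) : Prop :=
  forall i j, i <= j <= n -> d (a i) (a j) <= j - i <= 3 * d (a i) (a j).

Lemma quasi_path_inj n a i j :
  quasi_path n a -> i <= n -> j <= n -> a i = a j -> i = j.
Proof.
  intros q hi hj e.
  destruct (le_lt_dec i j).
  - pose proof (q i j ltac:(lia)) as h. rewrite e, (gm_refl d M) in h. lia.
  - pose proof (q j i ltac:(lia)) as h. rewrite e, (gm_refl d M) in h. lia.
Qed.

Lemma quasi_path_prefix n m a : m <= n -> quasi_path n a -> quasi_path m a.
Proof. intros h q i j hij; apply q; lia. Qed.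

Lemma quasi_path_rev n m a :
  m <= n -> quasi_path n a -> quasi_path m (fun i => a (n - i)).
Proof.
  intros h q i j hij. rewrite (gm_sym d M).
  pose proof (q (n - j) (n - i) ltac:(lia)). lia.
Qed.

Lemma geodesic_path_quasi n a : geodesic_path d n a -> quasi_path n a.
Proof. intros g i j hij; rewrite (g i j hij); lia. Qed.

Lemma geodesic_path_rev n m a :
  m <= n -> geodesic_path d n a -> geodesic_path d m (fun i => a (n - i)).
Proof.
  intros h q i j hij. rewrite (gm_sym d M).
  rewrite (q (n - j) (n - i) ltac:(lia)). lia.
Qed.

(** Let [w = a m = b 0].  Since [b] is geodesic, [w] is also a point of [a] nearest
    to any point [q] of [b].  So for [p] on [a] the distance from [q] to [w] is at
    most [d p q], that from [p] to [w] at most [2 * d p q], and the part of the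
    path from [p] to [q] has length at most [3 * d p q].  This holds in any
    metric space. *)
Lemma quasi_path_nearest m l a b :
  geodesic_path d m a -> geodesic_path d l b -> a m = b 0 ->
  (forall i, i <= m -> l <= d (a i) (b l)) -> quasi_path (m + l) (concat m a b).
Proof.
  intros ga gb ab near i j hij.
  destruct (le_lt_dec j m) as [jm|jm].
  { rewrite !concat_l by lia. rewrite ga; lia. }
  replace j with (m + (j - m)) by lia. rewrite (concat_r m a b (j - m) ab).
  destruct (le_lt_dec i m) as [im|im].
  - rewrite concat_l by lia.
    pose proof (ga i m ltac:(lia)) as g1.
    pose proof (gb 0 (j - m) ltac:(lia)) as g2. pose proof (gb (j - m) l ltac:(lia)).
    rewrite <- ab in g2. pose proof (near i im).
    pose proof (gm_tri d M (a i) (a m) (b (j - m))).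
    pose proof (gm_tri d M (a i) (b (j - m)) (a m)).
    rewrite (gm_sym d M (b (j - m)) (a m)) in *.
    pose proof (gm_tri d M (a i) (b (j - m)) (b l)). lia.
  - replace i with (m + (i - m)) by lia. rewrite (concat_r m a b (i - m) ab).
    rewrite gb; lia.
Qed.

Lemma nearest_on_path n (a : nat -> V) z :
  exists m, m <= n /\ forall i, i <= n -> d (a m) z <= d (a i) z.
Proof.
  induction n as [|n [m [hm h]]].
  - exists 0; split; auto. intros i hi; now replace i with 0 by lia.
  - destruct (le_lt_dec (d (a m) z) (d (a (S n)) z)).
    + exists m; split; [lia|]. intros i hi.
      destruct (Nat.eq_dec i (S n)) as [->|]; auto. apply h; lia.
    + exists (S n); split; [lia|]. intros i hi.
      destruct (Nat.eq_dec i (S n)) as [->|]; auto.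
      pose proof (h i ltac:(lia)); lia.
Qed.

End Metric.

Section Guessing.

Context {V : Type} {d : V -> V -> nat} (M : geodesic_metric d).

Definition chain (P : V -> Prop) : V -> V -> Prop :=
  clos_refl_trans_1n V (fun u v => P u /\ P v /\ d u v <= 1).

(** Discrete connectedness: two sets that cover a chain and contain one of its
    ends each come within distance 1 of each other. *)
Lemma chain_meets (P Q R : V -> Prop) x y :
  chain P x y -> P x -> (forall u, P u -> Q u \/ R u) -> Q x -> R y ->
  exists u v, P u /\ P v /\ Q u /\ R v /\ d u v <= 1.
Proof.
  intros c px qr; induction c as [x|x x' y [h1 [h2 h3]] c IH]; intros qx ry.
  - exists x, x; rewrite (gm_refl d M x); auto 7.
  - destruct (qr x' h2) as [q|r]; auto.
    exists x, x'; auto.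
Qed.

(** Sets that behave like geodesics.  Neither the paths nor their lengths are
    recorded: being joined by a chain inside the set replaces both. *)
Record thin_family (D : nat) (A : V -> V -> V -> Prop) : Prop := {
  tf_start : forall x y, A x y x;
  tf_sym : forall x y u, A x y u -> A y x u;
  tf_chain : forall x y, chain (A x y) x y;
  tf_small : forall x y u, d x y <= 1 -> A x y u -> d x u <= D;
  tf_thin : forall x y z u, A x y u ->
    exists u', (A x z u' \/ A y z u') /\ d u u' <= D
}.

Lemma exp_dominates (a b : nat) : exists k0, forall k, k0 <= k -> a * k + b < 2 ^ k.
Proof.
  set (j := 2 * a + b).
  assert (P : forall m, m + 1 <= 2 ^ m).
  { induction m as [|m IH]; simpl; lia. }
  exists (2 * j). intros k hk.
  replace k with (2 * j + (k - 2 * j)) by lia.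
  generalize (k - 2 * j); clear k hk.
  assert (Q : a * (2 * j) + b < 2 ^ (2 * j) /\ a <= 2 ^ (2 * j)).
  { replace (2 * j) with (j + j) by lia. rewrite Nat.pow_add_r.
    pose proof (P j). unfold j in *. split; nia. }
  revert Q; generalize (2 * j) as N; intros N Q i.
  induction i as [|i IH].
  - rewrite Nat.add_0_r; tauto.
  - rewrite Nat.add_succ_r, Nat.pow_succ_r'.
    assert (2 ^ N <= 2 ^ (N + i)) by (apply Nat.pow_le_mono_r; lia).
    lia.
Qed.

Context {D : nat} {A : V -> V -> V -> Prop} (T : thin_family D A).

(** Halve the interval [k] times: each thin triangle over a midpoint costs [D],
    and the last sets are those of points at distance at most 1. *)
Lemma family_near_interval_log k : forall x y u, d x y <= 2 ^ k -> A x y u ->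
  exists v, between d x v y /\ d u v <= D * (k + 1).
Proof.
  induction k as [|k IH]; intros x y u h hu.
  - exists x. unfold between. rewrite (gm_refl d M), (gm_sym d M u x).
    split; [lia|]. pose proof (tf_small D A T x y u h hu); lia.
  - pose proof (Nat.div_mod (d x y) 2 ltac:(lia)) as e.
    pose proof (Nat.mod_upper_bound (d x y) 2 ltac:(lia)).
    destruct (gm_split d M x y (d x y / 2) ltac:(lia)) as [m [h1 h2]].
    simpl in h.
    destruct (tf_thin D A T x y m u hu) as [u' [[h3|h3] h4]].
    + destruct (IH x m u' ltac:(lia) h3) as [v [h5 h6]].
      exists v. unfold between in *.
      pose proof (gm_tri d M u u' v). pose proof (gm_tri d M v m y).
      pose proof (gm_tri d M x v y). lia.
    + rewrite (gm_sym d M m y) in h2.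
      destruct (IH y m u' ltac:(lia) h3) as [v [h5 h6]].
      exists v. unfold between in *.
      pose proof (gm_tri d M u u' v). pose proof (gm_tri d M x m v).
      pose proof (gm_tri d M x v y). rewrite (gm_sym d M m v), (gm_sym d M v y) in *. lia.
Qed.

Definition family_within (n r : nat) : Prop :=
  forall x y u, d x y <= n -> A x y u -> exists v, between d x v y /\ d u v <= r.

(** Let [p] be a point between [x] and [y] within [r] of [u].  Cut the interval at
    [a] and [b] at distance [N] on both sides of [p] (or at the ends, if they are
    closer).  Points of [A x a] or [A y b] are within [r] of intervals that are
    too far from [p] to come close to [u], so [u] is close to [A a b], to which
    the logarithmic bound applies: the interval from [a] to [b] has length
    [O(r)], whatever the distance of [x] and [y]. *)
Lemma family_within_improve n r k :
  4 * r + 4 * D + 2 <= 2 ^ k -> family_within n r -> family_within n (D * (k + 4)).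
Proof.
  intros hk W x y u hn hu.
  destruct (W x y u hn hu) as [p [hp hup]]. unfold between in hp.
  (* [u] is [r]-close to [p], two thin triangles cost [2 * D], and the sets of
     the outer intervals are within [r] of them: hence the size of [N] *)
  set (N := 2 * r + 2 * D + 1).
  pose proof (gm_sym d M p x) as px.
  assert (exists a, between d x a p /\ d a p <= N /\ (a = x \/ d a p = N)) as [a [ha [haN ca]]].
  { destruct (le_lt_dec (d x p) N).
    - exists x; unfold between; rewrite (gm_refl d M); auto 6.
    - destruct (gm_split d M p x N ltac:(lia)) as [a [h1 h2]].
      exists a; unfold between.
      rewrite (gm_sym d M a p), (gm_sym d M x a); split; [|split]; auto; lia. }
  assert (exists b, between d p b y /\ d p b <= N /\ (b = y \/ d p b = N)) as [b [hb [hbN cb]]].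
  { destruct (le_lt_dec (d p y) N).
    - exists y; unfold between; rewrite (gm_refl d M); rewrite Nat.add_0_r; auto 6.
    - destruct (gm_split d M p y N ltac:(lia)) as [b [h1 h2]].
      exists b; unfold between; split; [|split]; auto; lia. }
  unfold between in *.
  pose proof (gm_tri d M x a y). pose proof (gm_tri d M a p y).
  pose proof (gm_tri d M x p b). pose proof (gm_tri d M x b y).
  pose proof (gm_tri d M x a b). pose proof (gm_tri d M a p b).
  pose proof (gm_tri d M a b y).
  assert (hl : forall u', d u u' <= 2 * D -> A x a u' ->
    exists v, d x v + d v y = d x y /\ d u v <= D * (k + 4)).
  { intros u' h1 h2. destruct ca as [->|ca].
    - exists x. rewrite (gm_refl d M). split; [lia|].
      pose proof (tf_small D A T x x u' ltac:(rewrite (gm_refl d M); lia) h2).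
      pose proof (gm_tri d M u u' x). rewrite (gm_sym d M u' x) in *. lia.
    - exfalso. destruct (W x a u' ltac:(lia) h2) as [v [h3 h4]]; unfold between in h3.
      pose proof (gm_tri d M x v p). pose proof (gm_tri d M v u' p).
      pose proof (gm_tri d M u' u p). rewrite (gm_sym d M v u'), (gm_sym d M u' u) in *. lia. }
  assert (hr : forall u', d u u' <= 2 * D -> A y b u' ->
    exists v, d x v + d v y = d x y /\ d u v <= D * (k + 4)).
  { intros u' h1 h2. destruct cb as [->|cb].
    - exists y. rewrite (gm_refl d M). split; [lia|].
      pose proof (tf_small D A T y y u' ltac:(rewrite (gm_refl d M); lia) h2).
      pose proof (gm_tri d M u u' y). rewrite (gm_sym d M u' y) in *. lia.
    - exfalso. pose proof (gm_sym d M y b).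
      destruct (W y b u' ltac:(lia) h2) as [v [h3 h4]]; unfold between in h3.
      pose proof (gm_tri d M p v y). pose proof (gm_tri d M p u v).
      pose proof (gm_sym d M p u). pose proof (gm_tri d M u u' v).
      rewrite (gm_sym d M v y) in *. lia. }
  destruct (tf_thin D A T x y a u hu) as [u1 [[h1|h1] h2]].
  { apply (hl u1); auto; lia. }
  destruct (tf_thin D A T y a b u1 h1) as [u2 [[h3|h3] h4]];
    pose proof (gm_tri d M u u1 u2).
  { apply (hr u2); auto; lia. }
  destruct (family_near_interval_log k a b u2 ltac:(lia) h3) as [v [h5 h6]].
  exists v. unfold between in h5. pose proof (gm_tri d M u u2 v).
  pose proof (gm_tri d M x a v). pose proof (gm_tri d M v b y).
  pose proof (gm_tri d M x v y). lia.
Qed.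

(** Start from the logarithmic bound, which depends on the distance of the
    endpoints, and improve it until it stops decreasing; since [D * (k + 4)] is
    logarithmic in [r], this happens at a value that depends on [D] alone. *)
Lemma family_near_interval :
  exists r, forall x y u, A x y u -> exists v, between d x v y /\ d u v <= r.
Proof.
  destruct (exp_dominates (4 * D) (24 * D + 6)) as [k0 hk0].
  set (R0 := 2 ^ k0 + D * (k0 + 5)).
  exists R0. intros x y u hu.
  assert (W : family_within (d x y) R0).
  2:{ apply (W x y u); auto. }
  generalize (d x y) as n; clear x y u hu; intros n.
  assert (W0 : family_within n (D * (n + 1))).
  { intros x y u hn hu. apply family_near_interval_log; auto.
    pose proof (Nat.pow_gt_lin_r 2 n ltac:(lia)); lia. }
  revert W0; generalize (D * (n + 1)) as r.
  induction r as [r IH] using (well_founded_induction lt_wf). intros W.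
  destruct (le_lt_dec r R0) as [l|l].
  { intros x y u h1 h2. destruct (W x y u h1 h2) as [v [h3 h4]].
    exists v; split; auto; lia. }
  set (m := 4 * r + 4 * D + 2).
  destruct (Nat.log2_up_spec m ltac:(lia)) as [l1 l2].
  set (k := Nat.log2_up m) in *.
  apply (IH (D * (k + 4))); [|apply (family_within_improve n r k); auto].
  destruct (le_lt_dec k k0) as [c|c].
  - assert (D * (k + 4) <= D * (k0 + 4)) by (apply Nat.mul_le_mono_l; lia).
    assert (D * (k0 + 5) = D * (k0 + 4) + D) by lia.
    pose proof (Nat.pow_nonzero 2 k0). lia.
  - pose proof (hk0 (pred k) ltac:(lia)) as h.
    replace k with (S (pred k)) by lia. generalize dependent (pred k). intros i; intros.
    replace (D * (S i + 4)) with (D * i + 5 * D) by lia.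
    lia.
Qed.

Lemma family_between :
  exists r, forall x y u, A x y u -> d x u + d u y <= d x y + r.
Proof.
  destruct family_near_interval as [r hr]. exists (2 * r). intros x y u hu.
  destruct (hr x y u hu) as [v [h1 h2]]; unfold between in h1.
  pose proof (gm_tri d M x v u). pose proof (gm_tri d M u v y).
  rewrite (gm_sym d M v u) in *. lia.
Qed.

(** The Gromov product of [x] and [y] at [w] is, up to a constant, at least the
    distance from [w] to [A x y].  Walking along a chain in [A x y] from [x] to
    [y], at some point one passes from being near [A x w] to being near [A y w];
    this point is nearly between [x] and [w] and nearly between [y] and [w]. *)
Lemma family_product :
  exists K, forall w x y, exists p, A x y p /\ 2 * d w p + d x y <= d x w + d w y + K.
Proof.
  destruct family_between as [r hr].
  exists (4 * D + 2 * r + 2). intros w x y.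
  destruct (chain_meets (A x y)
    (fun u => exists u', A x w u' /\ d u u' <= D)
    (fun u => exists u', A y w u' /\ d u u' <= D) x y)
    as [u [v [hu [hv [[u' [h1 h2]] [[v' [h3 h4]] h5]]]]]].
  - apply (tf_chain D A T).
  - apply (tf_start D A T).
  - intros u hu. destruct (tf_thin D A T x y w u hu) as [u' [[h|h] h']]; [left|right]; eauto.
  - exists x; split; [apply (tf_start D A T)|rewrite (gm_refl d M); lia].
  - exists y; split; [apply (tf_start D A T)|rewrite (gm_refl d M); lia].
  - exists u; split; auto.
    pose proof (hr _ _ _ h1). pose proof (hr _ _ _ h3).
    pose proof (gm_sym d M y w). pose proof (gm_sym d M w u).
    pose proof (gm_tri d M u u' w). pose proof (gm_tri d M x u y).
    pose proof (gm_tri d M x u' u). pose proof (gm_sym d M u' u).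
    pose proof (gm_tri d M u v v'). pose proof (gm_tri d M u v' w).
    pose proof (gm_tri d M u v' y). pose proof (gm_sym d M v' y). lia.
Qed.

(** A point of [A x z] realizing the product at [w] is near [A x y] or [A z y],
    which bounds one of the two other products. *)
Lemma thin_family_four_point : exists K, four_point K d.
Proof.
  destruct family_between as [r hr]. destruct family_product as [K hK].
  exists (K + 2 * D + r). intros w x y z.
  destruct (hK w x z) as [p [hp h]].
  destruct (tf_thin D A T x z y p hp) as [q [[hq|hq] hpq]];
    pose proof (hr _ _ _ hq);
    pose proof (gm_tri d M w p q);
    pose proof (gm_sym d M w q);
    pose proof (gm_tri d M y q w); pose proof (gm_sym d M y q);
    pose proof (gm_sym d M y w); pose proof (gm_sym d M x w); pose proof (gm_sym d M w z);
    pose proof (gm_sym d M y z).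
  - pose proof (gm_tri d M x q w). left; lia.
  - pose proof (gm_tri d M z q w). pose proof (gm_sym d M z w). right; lia.
Qed.

End Guessing.

(** * The vertex metric of a connected graph *)

Section GraphMetric.

Context {G : graph}.

Definition adjacent (u v : vert G) : Prop :=
  exists e, (src e = u /\ tgt e = v) \/ (src e = v /\ tgt e = u).

Inductive steps : nat -> vert G -> vert G -> Prop :=
| steps_nil v : steps 0 v v
| steps_cons n u v w : adjacent u v -> steps n v w -> steps (S n) u w.

(** The least number of edges of a path; meaningful for connected graphs. *)
Definition vdist (u v : vert G) : nat :=
  epsilon (inhabits 0) (fun n => steps n u v /\ forall m, steps m u v -> n <= m).

Lemma adjacent_sym u v : adjacent u v -> adjacent v u.
Proof. intros [e h]; exists e; tauto. Qed.

Lemma steps_app n m u v w : steps n u v -> steps m v w -> steps (n + m) u w.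
Proof. induction 1; intros h; simpl; auto. econstructor; eauto. Qed.

Lemma steps_sym n u v : steps n u v -> steps n v u.
Proof.
  induction 1 as [|n u v w h _ IH]; [constructor|].
  rewrite <- Nat.add_1_r. apply (steps_app _ _ _ _ _ IH).
  econstructor; [apply adjacent_sym; eauto|constructor].
Qed.

Lemma at_pos_range (e : edge G) s x : at_pos e s x -> (0 <= s <= 1)%R.
Proof. destruct 1; lra. Qed.

Lemma walk_nonneg (x y : point G) l : walk x y l -> (0 <= l)%R.
Proof. induction 1; [lra|]. pose proof (Rabs_pos (s - t)); lra. Qed.

Lemma walk_app (x y z : point G) l m : walk x y l -> walk y z m -> walk x z (l + m).
Proof.
  induction 1 as [|e s t x y w l a b _ IH]; intros h.
  - now rewrite Rplus_0_l.
  - rewrite Rplus_assoc. econstructor; eauto.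
Qed.

Lemma walk_edge (e : edge G) s t x y : at_pos e s x -> at_pos e t y -> walk x y (Rabs (s - t)).
Proof.
  intros a b. rewrite <- (Rplus_0_r (Rabs (s - t))). econstructor; eauto; constructor.
Qed.

Lemma walk_rev (x y : point G) l : walk x y l -> walk y x l.
Proof.
  induction 1 as [|e s t x y w l a b _ IH]; [constructor|].
  rewrite Rplus_comm. apply (walk_app _ _ _ _ _ IH).
  rewrite Rabs_minus_sym. eapply walk_edge; eauto.
Qed.

Lemma adjacent_walk u v : adjacent u v -> walk (pvert u) (pvert v) 1.
Proof.
  intros [e h]. replace 1%R with (Rabs (0 - 1))%R.
  2:{ rewrite Rabs_left; lra. }
  destruct h as [[<- <-]|[<- <-]]; [|apply walk_rev];
    apply (walk_edge e); constructor.
Qed.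

Lemma steps_walk n u v : steps n u v -> walk (pvert u) (pvert v) (INR n).
Proof.
  induction 1 as [|n u v w h _ IH]; [constructor|].
  rewrite S_INR, Rplus_comm. eapply walk_app; eauto using adjacent_walk.
Qed.

Lemma point_vertex (x : point G) : exists v,
  walk (pvert v) x (match x with pvert _ => 0 | pedge _ t _ => t end)%R.
Proof.
  destruct x as [v|e t ht].
  - exists v; constructor.
  - exists (src e). replace t with (Rabs (0 - t)) at 2.
    + apply (walk_edge e); constructor.
    + rewrite Rabs_left; lra.
Qed.

(** Walks run through interior points of edges; feet let them be followed on the
    vertices. *)
Definition foot (x : point G) (v : vert G) : Prop :=
  match x with pvert u => u = v | pedge e _ _ => src e = v \/ tgt e = v end.

Lemma at_pos_foot (e : edge G) s x v : at_pos e s x -> foot x v -> exists n, steps n v (src e).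
Proof.
  assert (h : steps 1 (tgt e) (src e)).
  { econstructor; [exists e; eauto|constructor]. }
  destruct 1; simpl.
  - intros <-; exists 0; constructor.
  - intros <-; eauto.
  - intros [<-|<-]; [exists 0; constructor|eauto].
Qed.

Lemma walk_foot (x y : point G) l u v :
  walk x y l -> foot x u -> foot y v -> exists n, steps n u v.
Proof.
  intros h; revert u; induction h as [x|e s t x y w l a b _ IH]; intros u hu hv.
  - destruct x as [w|e t ht]; simpl in *.
    + subst; exists 0; constructor.
    + assert (a : at_pos e t (pedge e t ht)) by constructor.
      destruct (at_pos_foot e t _ u a hu) as [n hn].
      destruct (at_pos_foot e t _ v a hv) as [m hm].
      exists (n + m). eapply steps_app; eauto using steps_sym.
  - assert (exists y0, foot y y0) as [y0 hy0].
    { destruct y as [v0|e0 t0 h0]; [exists v0|exists (src e0)]; simpl; auto. }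
    destruct (IH y0 hy0 hv) as [n hn].
    destruct (at_pos_foot e s _ u a hu) as [m hm].
    destruct (at_pos_foot e t _ y0 b hy0) as [k hk].
    exists (m + (k + n)). eapply steps_app; eauto. eapply steps_app; eauto using steps_sym.
Qed.

Lemma connected_intro (v0 : vert G) :
  (forall v, exists n, steps n v0 v) -> connected G.
Proof.
  intros h; split; [exact (inhabits (pvert v0))|]. intros x y.
  destruct (point_vertex x) as [u hu]. destruct (point_vertex y) as [v hv].
  destruct (h u) as [n hn]. destruct (h v) as [m hm].
  apply steps_walk in hn, hm.
  eexists. eapply walk_app; [apply walk_rev, hu|].
  eapply walk_app; [apply walk_rev, hn|]. eapply walk_app; eauto.
Qed.

Context (conn : connected G).

Lemma connected_vertex : inhabited (vert G).
Proof. destruct conn as [[x] _]. destruct (point_vertex x) as [v _]. exact (inhabits v). Qed.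

Lemma steps_exist u v : exists n, steps n u v.
Proof.
  destruct (proj2 conn (pvert u) (pvert v)) as [l hl].
  apply (walk_foot _ _ _ u v hl); reflexivity.
Qed.

Lemma vdist_spec u v : steps (vdist u v) u v /\ forall m, steps m u v -> vdist u v <= m.
Proof.
  unfold vdist. apply epsilon_spec. destruct (steps_exist u v) as [n hn].
  revert hn; induction n as [n IH] using (well_founded_induction lt_wf); intros hn.
  destruct (classic (exists m, m < n /\ steps m u v)) as [[m [h1 h2]]|h]; eauto.
  exists n; split; auto. intros m hm. destruct (le_lt_dec n m); auto.
  exfalso; eauto.
Qed.

Lemma vdist_steps u v : steps (vdist u v) u v.
Proof. apply vdist_spec. Qed.

Lemma vdist_min n u v : steps n u v -> vdist u v <= n.
Proof. apply vdist_spec. Qed.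

Lemma vdist_geodesic : geodesic_metric vdist.
Proof.
  split.
  - intros x. pose proof (vdist_min 0 x x (steps_nil x)); lia.
  - intros x y h. pose proof (vdist_steps x y) as s; rewrite h in s; now inversion s.
  - intros x y. apply Nat.le_antisymm; apply vdist_min, steps_sym, vdist_steps.
  - intros x y z. apply vdist_min. eapply steps_app; apply vdist_steps.
  - intros x y i hi.
    assert (exists z, steps i x z /\ steps (vdist x y - i) z y) as [z [h1 h2]].
    { pose proof (vdist_steps x y) as s. revert s hi; generalize (vdist x y) as n.
      intros n; revert x i; induction n as [|n IH]; intros x i s hi.
      - replace i with 0 by lia. exists x; split; [constructor|exact s].
      - destruct i as [|i]; [exists x; split; [constructor|exact s]|].
        inversion s as [|? ? v ? a b]; subst.
        destruct (IH v i b ltac:(lia)) as [z [h1 h2]].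
        exists z; split; auto. econstructor; eauto. }
    exists z. pose proof (vdist_min _ _ _ h1). pose proof (vdist_min _ _ _ h2).
    pose proof (vdist_min _ _ _ (steps_app _ _ _ _ _ (vdist_steps x z) (vdist_steps z y))).
    lia.
Qed.

Lemma adjacent_vdist u v : adjacent u v -> vdist u v <= 1.
Proof. intros h. apply vdist_min. econstructor; eauto; constructor. Qed.

Lemma vdist_adjacent u v : vdist u v = 1 -> adjacent u v.
Proof.
  intros h. pose proof (vdist_steps u v) as s; rewrite h in s.
  inversion s as [|? ? w ? a b]; subst. inversion b; subst; auto.
Qed.

(** The distance to the vertex [o].  Being 1-Lipschitz along edges, it bounds the
    lengths of walks starting at [o] from below ([height_walk]); this is how
    [dist] is computed on vertices. *)
Definition height (o : vert G) (x : point G) : R :=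
  match x with
  | pvert v => INR (vdist o v)
  | pedge e t _ => Rmin (INR (vdist o (src e)) + t) (INR (vdist o (tgt e)) + 1 - t)
  end.

Lemma height_at_pos o (e : edge G) s x : at_pos e s x ->
  height o x = Rmin (INR (vdist o (src e)) + s) (INR (vdist o (tgt e)) + 1 - s).
Proof.
  assert (h : (INR (vdist o (src e)) <= INR (vdist o (tgt e)) + 1 /\
    INR (vdist o (tgt e)) <= INR (vdist o (src e)) + 1)%R).
  { assert (a : adjacent (src e) (tgt e)) by (exists e; auto).
    pose proof (adjacent_vdist _ _ a). pose proof (adjacent_vdist _ _ (adjacent_sym _ _ a)).
    pose proof (gm_tri _ vdist_geodesic o (src e) (tgt e)).
    pose proof (gm_tri _ vdist_geodesic o (tgt e) (src e)).
    rewrite <- !S_INR. split; apply le_INR; lia. }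
  destruct 1; simpl.
  - rewrite Rmin_left; lra.
  - rewrite Rmin_right; lra.
  - reflexivity.
Qed.

Lemma height_walk o (x y : point G) l : walk x y l -> (height o y <= height o x + l)%R.
Proof.
  induction 1 as [x|e s t x y w l a b _ IH]; [lra|].
  apply (height_at_pos o) in a, b. rewrite a. rewrite b in IH.
  apply Rle_trans with (1 := IH).
  pose proof (Rle_abs (s - t)). pose proof (Rle_abs (t - s)).
  rewrite (Rabs_minus_sym t s) in *.
  unfold Rmin; repeat destruct Rle_dec; lra.
Qed.

Local Open Scope R_scope.

(** The infimum defining [dist] is finite: there is a walk, and 0 is a lower
    bound. *)
Lemma dist_glb (x y : point G) : is_glb_Rbar (walk x y) (Finite (dist x y)).
Proof.
  unfold dist. pose proof (Glb_Rbar_correct (walk x y)) as h.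
  replace (Finite (real (Glb_Rbar (walk x y)))) with (Glb_Rbar (walk x y)); auto.
  destruct (proj2 conn x y) as [l hl].
  destruct h as [h1 h2]. pose proof (h1 l hl) as h3.
  pose proof (h2 (Finite 0) (fun m hm => walk_nonneg _ _ _ hm)) as h4.
  destruct (Glb_Rbar (walk x y)); simpl in *; tauto || reflexivity.
Qed.

Lemma dist_le (x y : point G) l : walk x y l -> dist x y <= l.
Proof. intros h. apply (proj1 (dist_glb x y) l h). Qed.

Lemma dist_ge (x y : point G) b : (forall l, walk x y l -> b <= l) -> b <= dist x y.
Proof. intros h. apply (proj2 (dist_glb x y) (Finite b) h). Qed.

Lemma dist_pos (x y : point G) : 0 <= dist x y.
Proof. apply dist_ge, walk_nonneg. Qed.

Lemma dist_refl (x : point G) : dist x x = 0.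
Proof. apply Rle_antisym; [apply dist_le; constructor|apply dist_pos]. Qed.

Lemma dist_sym (x y : point G) : dist x y = dist y x.
Proof. apply Rle_antisym; apply dist_ge; intros l hl; apply dist_le, walk_rev, hl. Qed.

Lemma dist_tri (x y z : point G) : dist x z <= dist x y + dist y z.
Proof.
  cut (dist x z - dist y z <= dist x y); [lra|]. apply dist_ge; intros l hl.
  cut (dist x z - l <= dist y z); [lra|]. apply dist_ge; intros m hm.
  pose proof (dist_le _ _ _ (walk_app _ _ _ _ _ hl hm)); lra.
Qed.

Lemma dist_vertex u v : dist (pvert u) (pvert v) = INR (vdist u v).
Proof.
  apply Rle_antisym.
  - apply dist_le, steps_walk, vdist_steps.
  - apply dist_ge; intros l hl. apply (height_walk u) in hl. simpl in hl.
    rewrite (gm_refl _ vdist_geodesic u) in hl. simpl in hl; lra.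
Qed.

Lemma nearby_vertex (x : point G) : exists v, dist (pvert v) x <= 1.
Proof.
  destruct (point_vertex x) as [v h]. exists v.
  apply dist_le in h. apply Rle_trans with (1 := h). destruct x; simpl; lra.
Qed.

Lemma four_point_of_hyperbolic K (delta : R) :
  delta_hyperbolic delta G -> 2 * delta <= INR K -> four_point K (@vdist).
Proof.
  intros h hK w x y z.
  specialize (h (pvert w) (pvert x) (pvert y) (pvert z)).
  unfold gromov_product in h. rewrite !dist_vertex in h.
  revert h; unfold Rmin; destruct Rle_dec; intros h; [left|right];
    apply INR_le; rewrite !plus_INR; lra.
Qed.

Lemma hyperbolic_of_four_point K : four_point K (@vdist) -> hyperbolic G.
Proof.
  intros h. exists (INR K / 2 + 6).
  split; [pose proof (pos_INR K); lra|].
  intros w' x' y' z'.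
  destruct (nearby_vertex w') as [w hw]. destruct (nearby_vertex x') as [x hx].
  destruct (nearby_vertex y') as [y hy]. destruct (nearby_vertex z') as [z hz].
  assert (close : forall (a b : vert G) (a' b' : point G),
    dist (pvert a) a' <= 1 -> dist (pvert b) b' <= 1 ->
    INR (vdist a b) - 2 <= dist a' b' <= INR (vdist a b) + 2).
  { intros a b a' b' ha hb. rewrite <- dist_vertex.
    pose proof (dist_tri (pvert a) a' (pvert b)). pose proof (dist_tri a' b' (pvert b)).
    pose proof (dist_tri a' (pvert a) b'). pose proof (dist_tri (pvert a) (pvert b) b').
    rewrite (dist_sym a' (pvert a)), (dist_sym b' (pvert b)) in *. lra. }
  pose proof (close x w x' w' hx hw). pose proof (close y w y' w' hy hw).
  pose proof (close z w z' w' hz hw). pose proof (close x y x' y' hx hy).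
  pose proof (close y z y' z' hy hz). pose proof (close x z x' z' hx hz).
  unfold gromov_product.
  destruct (h w x y z) as [q|q]; apply le_INR in q; rewrite !plus_INR in q;
    unfold Rmin; destruct Rle_dec; lra.
Qed.

End GraphMetric.

(** * Realizing sequences of vertices by simplicial paths *)

Section Realization.

Context {G : graph}.

Local Open Scope R_scope.

Definition edge_point (e : edge G) (t : R) : point G :=
  match Rlt_dec 0 t, Rlt_dec t 1 with
  | left a, left b => pedge e t (conj a b)
  | left _, right _ => pvert (tgt e)
  | right _, _ => pvert (src e)
  end.

Lemma edge_point_at_pos (e : edge G) t : 0 <= t <= 1 -> at_pos e t (edge_point e t).
Proof.
  intros h; unfold edge_point. destruct (Rlt_dec 0 t); [destruct (Rlt_dec t 1)|].
  - constructor.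
  - replace t with 1 by lra. constructor.
  - replace t with 0 by lra. constructor.
Qed.

Lemma at_pos_edge_point (e : edge G) t x : at_pos e t x -> x = edge_point e t.
Proof.
  destruct 1 as [| |t ht]; unfold edge_point.
  - destruct (Rlt_dec 0 0); [exfalso; lra|reflexivity].
  - destruct (Rlt_dec 0 1); [destruct (Rlt_dec 1 1)|]; reflexivity || (exfalso; lra).
  - destruct (Rlt_dec 0 t); [destruct (Rlt_dec t 1)|]; try (exfalso; lra).
    f_equal; apply proof_irrelevance.
Qed.

(** A parametrization at unit speed of an edge from [u] to [v], in either
    direction.  By [arc_interior], a realized path is at a vertex only at
    integer times. *)
Record arc (u v : vert G) (f : R -> point G) : Prop := {
  arc_start : f 0 = pvert u;
  arc_end : f 1 = pvert v;
  arc_walk : forall s t, 0 <= s <= 1 -> 0 <= t <= 1 -> walk (f s) (f t) (Rabs (s - t));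
  arc_image : exists e, forall x, (exists t, 0 <= t <= 1 /\ f t = x) <-> on_edge e x;
  arc_interior : forall t w, 0 < t < 1 -> f t <> pvert w
}.

Lemma adjacent_arc u v : adjacent u v -> exists f, arc u v f.
Proof.
  assert (E : forall e, arc (src e) (tgt e) (edge_point e)).
  { intros e; split.
    - symmetry; apply at_pos_edge_point; constructor.
    - symmetry; apply at_pos_edge_point; constructor.
    - intros s t hs ht. eapply walk_edge; apply edge_point_at_pos; auto.
    - exists e; intros x; split.
      + intros [t [ht <-]]. exists t; now apply edge_point_at_pos.
      + intros [t ht]. exists t; split; [eapply at_pos_range; eauto|].
        symmetry; now apply at_pos_edge_point.
    - intros t w ht; unfold edge_point.
      destruct (Rlt_dec 0 t); [destruct (Rlt_dec t 1)|]; discriminate || (exfalso; lra). }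
  intros [e [[<- <-]|[<- <-]]]; [exists (edge_point e); auto|].
  destruct (E e) as [h0 h1 hw [e' he] hi].
  exists (fun t => edge_point e (1 - t)); split.
  - now rewrite Rminus_0_r.
  - now rewrite Rminus_diag.
  - intros s t hs ht. replace (s - t) with ((1 - t) - (1 - s)) by lra.
    rewrite Rabs_minus_sym. apply hw; lra.
  - exists e'; intros x; rewrite <- he; split; intros [t [ht hx]];
      exists (1 - t); (split; [lra|]); auto.
    now replace (1 - (1 - t)) with t by lra.
  - intros t w ht. apply hi; lra.
Qed.

Record realizes (n : nat) (a : nat -> vert G) (g : R -> point G) : Prop := {
  rz_vertex : forall k, (k <= n)%nat -> g (INR k) = pvert (a k);
  rz_arc : forall k, (k < n)%nat -> exists f, arc (a k) (a (S k)) f /\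
    forall t, INR k <= t <= INR (S k) -> g t = f (t - INR k)
}.

Lemma realization_exists n a :
  (forall k, (k < n)%nat -> adjacent (a k) (a (S k))) -> exists g, realizes n a g.
Proof.
  induction n as [|n IH]; intros h.
  - exists (fun _ => pvert (a 0%nat)); split; intros k hk; [|lia].
    now replace k with 0%nat by lia.
  - destruct IH as [g [g1 g2]]; [intros; apply h; lia|].
    destruct (adjacent_arc _ _ (h n ltac:(lia))) as [f hf].
    assert (I : forall k, (k <= n)%nat -> INR k <= INR n) by (intros; now apply le_INR).
    exists (fun t => if Rle_dec t (INR n) then g t else f (t - INR n)); split; intros k hk.
    + destruct (Rle_dec (INR k) (INR n)) as [c|c].
      * apply g1. now apply INR_le.
      * assert (k = S n) as ->.
        { assert (~ (k <= n)%nat) by auto. lia. }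
        rewrite S_INR. replace (INR n + 1 - INR n) with 1 by lra. apply hf.
    + destruct (Nat.eq_dec k n) as [->|c].
      * exists f; split; auto. intros t ht. destruct (Rle_dec t (INR n)) as [d|d]; auto.
        replace t with (INR n) by lra. rewrite g1, Rminus_diag by lia. symmetry; apply hf.
      * destruct (g2 k ltac:(lia)) as [f' [h1 h2]]. exists f'; split; auto.
        intros t ht. pose proof (I (S k) ltac:(lia)).
        destruct (Rle_dec t (INR n)); [auto|lra].
Qed.

Lemma locate n t : 0 <= t <= INR n ->
  t = 0 \/ exists k, (k < n)%nat /\ INR k <= t <= INR (S k).
Proof.
  induction n as [|n IH]; intros h; [simpl in h; left; lra|].
  destruct (Rle_dec t (INR n)) as [c|c].
  - destruct IH as [q|[k [h1 h2]]]; auto; [lra|]. right; exists k; split; auto.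
  - right; exists n; split; [lia|lra].
Qed.

Context (conn : connected G).

Lemma realization_lipschitz n a g : realizes n a g ->
  forall s t, 0 <= s <= INR n -> 0 <= t <= INR n -> dist (g s) (g t) <= Rabs (s - t).
Proof.
  intros [g1 g2].
  cut (forall m, (m <= n)%nat -> forall s t, 0 <= s <= INR m -> 0 <= t <= INR m ->
    s <= t -> dist (g s) (g t) <= t - s).
  { intros h s t hs ht. destruct (Rle_dec s t) as [c|c].
    - rewrite Rabs_left1 by lra. pose proof (h n (le_n n) s t hs ht c); lra.
    - rewrite Rabs_right, (dist_sym conn) by lra.
      pose proof (h n (le_n n) t s ht hs ltac:(lra)); lra. }
  induction m as [|m IH]; intros hm s t hs ht st.
  - simpl in *. replace s with 0 by lra. replace t with 0 by lra.
    rewrite (dist_refl conn); lra.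
  - destruct (g2 m ltac:(lia)) as [f [hf hg]].
    assert (E : forall s t, INR m <= s <= t -> t <= INR (S m) -> dist (g s) (g t) <= t - s).
    { intros s' t' h1 h2. rewrite !hg by lra. apply (dist_le conn).
      replace (t' - s') with (Rabs ((s' - INR m) - (t' - INR m)))
        by (rewrite Rabs_left1; lra).
      rewrite S_INR in h2. apply hf; lra. }
    destruct (Rle_dec t (INR m)); [apply IH; lia || lra|].
    destruct (Rle_dec (INR m) s); [apply E; lra|].
    pose proof (pos_INR m).
    pose proof (IH ltac:(lia) s (INR m) ltac:(lra) ltac:(lra) ltac:(lra)).
    pose proof (E (INR m) t ltac:(lra) ltac:(lra)).
    pose proof (dist_tri conn (g s) (g (INR m)) (g t)). lra.
Qed.

Lemma realization_vertex_integral n a g t v : realizes n a g ->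
  0 <= t <= INR n -> g t = pvert v -> exists k, (k <= n)%nat /\ t = INR k.
Proof.
  intros [g1 g2] ht hv. destruct (locate n t ht) as [->|[k [h1 h2]]].
  { exists 0%nat; split; [lia|reflexivity]. }
  destruct (g2 k h1) as [f [hf hg]]. rewrite hg in hv by auto.
  rewrite S_INR in h2.
  destruct (Req_dec t (INR k)) as [|c1]; [exists k; split; auto; lia|].
  destruct (Req_dec t (INR k + 1)) as [|c2].
  { exists (S k); rewrite S_INR; split; auto. }
  exfalso. apply (arc_interior _ _ _ hf (t - INR k) v); auto. lra.
Qed.

Lemma realization_simplicial n a g : realizes n a g -> simplicial_path 0 (Z.of_nat n) g.
Proof.
  intros r; split; [lia|split; [|split]].
  - intros t ht eps heps. exists eps; split; auto. intros s hs hst.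
    rewrite <- INR_IZR_INZ in ht, hs.
    apply Rle_lt_trans with (2 := hst). apply (realization_lipschitz n a); auto.
  - intros k hk. exists (a (Z.to_nat k)).
    rewrite <- (rz_vertex _ _ _ r) by lia. f_equal.
    rewrite INR_IZR_INZ, Z2Nat.id by lia. reflexivity.
  - intros k hk. left. destruct (rz_arc _ _ _ r (Z.to_nat k) ltac:(lia)) as [f [hf hg]].
    rewrite S_INR, INR_IZR_INZ, Z2Nat.id in hg by lia. rewrite plus_IZR.
    destruct (arc_image _ _ _ hf) as [e he]. exists e; intros x. rewrite <- he.
    split; intros [t [ht hx]].
    + exists (t - IZR k); split; [lra|]. now rewrite <- hg by lra.
    + exists (t + IZR k); split; [lra|]. rewrite hg by lra.
      now replace (t + IZR k - IZR k) with t by lra.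
Qed.

(** Rounding both times to integers changes their distance and that of the points
    by at most 2 each, which the additive constant 3 absorbs. *)
Lemma realization_quasi_geodesic n a g :
  realizes n a g -> quasi_path (d := vdist) n a -> quasi_geodesic 3 0 (Z.of_nat n) g.
Proof.
  intros r q s t hs ht. rewrite <- INR_IZR_INZ in hs, ht. simpl in hs, ht.
  pose proof (realization_lipschitz n a g r) as L.
  split.
  2:{ pose proof (L s t hs ht). pose proof (Rabs_pos (s - t)); lra. }
  assert (near : forall t, 0 <= t <= INR n -> exists k, (k <= n)%nat /\
    Rabs (t - INR k) <= 1 /\ dist (g t) (pvert (a k)) <= 1).
  { intros t' ht'. destruct (locate n t' ht') as [->|[k [h1 h2]]].
    - exists 0%nat; split; [lia|]. rewrite <- (rz_vertex _ _ _ r) by lia.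
      simpl. rewrite Rminus_0_r, Rabs_R0, (dist_refl conn). lra.
    - exists k; split; [lia|]. rewrite S_INR in h2.
      assert (Rabs (t' - INR k) <= 1) by (rewrite Rabs_right; lra).
      split; auto. rewrite <- (rz_vertex _ _ _ r) by lia.
      assert (INR k <= INR n) by (apply le_INR; lia). pose proof (pos_INR k).
      pose proof (L t' (INR k) ht' ltac:(lra)). lra. }
  destruct (near s hs) as [i [hi [i1 i2]]]. destruct (near t ht) as [j [hj [j1 j2]]].
  pose proof (dist_tri conn (pvert (a i)) (g s) (pvert (a j))) as t1.
  pose proof (dist_tri conn (g s) (g t) (pvert (a j))) as t2.
  rewrite (dist_sym conn (pvert (a i)) (g s)) in t1. rewrite (dist_vertex conn) in t1.
  assert (Rabs (INR i - INR j) <= 3 * INR (vdist (a i) (a j))).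
  { destruct (le_lt_dec i j) as [c|c].
    - pose proof (q i j ltac:(lia)) as [_ h]. apply le_INR in h, c.
      rewrite mult_INR in h. rewrite minus_INR in h by now apply INR_le.
      rewrite Rabs_left1 by lra. simpl in h; lra.
    - pose proof (q j i ltac:(lia)) as [_ h]. apply lt_INR in c. apply le_INR in h.
      rewrite mult_INR in h. rewrite minus_INR in h by (apply INR_le; lra).
      rewrite Rabs_right by lra.
      rewrite (gm_sym _ (vdist_geodesic conn) (a i)). simpl in h; lra. }
  revert i1 j1 H. unfold Rabs; repeat destruct Rcase_abs; lra.
Qed.

End Realization.

(** * Electrification and bounded penetration *)

Section Electrification.

Context {G : graph} {C : Type} (H : C -> vert G -> Prop).
Context (connG : connected G).
Context (connH : forall c, connected (full_subgraph G (H c))).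

Notation base v := (@inl (vert G) C v).
Notation cone c := (@inr (vert G) C c).
Notation dG := (@vdist G).
Notation member c := {v : vert G | H c v}.

Definition dE : vert G + C -> vert G + C -> nat := @vdist (electrification G C H).

Definition dH (c : C) : member c -> member c -> nat := @vdist (full_subgraph G (H c)).

Lemma dH_geodesic c : geodesic_metric (dH c).
Proof. exact (vdist_geodesic (connH c)). Qed.

Lemma electrification_adjacent (u v : vert G) :
  @adjacent G u v <-> @adjacent (electrification G C H) (base u) (base v).
Proof.
  split.
  - intros [e h]; exists (inl e); simpl. destruct h as [[<- <-]|[<- <-]]; auto.
  - intros [[e|q] h]; simpl in h.
    + exists e. destruct h as [[h1 h2]|[h1 h2]]; injection h1; injection h2; auto.
    + destruct h as [[h1 h2]|[h1 h2]]; discriminate.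
Qed.

Lemma cone_adjacent c v :
  @adjacent (electrification G C H) (base v) (cone c) <-> H c v.
Proof.
  split.
  - intros [[e|[[c' v'] q]] h]; simpl in h; [destruct h as [[h1 h2]|[h1 h2]]; discriminate|].
    destruct h as [[h1 h2]|[h1 h2]]; try discriminate.
    injection h1; injection h2; simpl; intros; subst; exact q.
  - intros h. exists (inr (exist _ (c, v) h)); simpl; auto.
Qed.

Lemma electrification_steps n (u v : vert G) :
  @steps G n u v -> @steps (electrification G C H) n (base u) (base v).
Proof.
  induction 1 as [|n u v w h _ IH]; [constructor|].
  apply (@steps_cons (electrification G C H) n (base u) (base v)); auto.
  now apply electrification_adjacent.
Qed.

Lemma electrification_connected : connected (electrification G C H).
Proof.
  destruct (connected_vertex connG) as [v0].
  apply (@connected_intro (electrification G C H) (base v0)). intros [v|c].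
  - destruct (steps_exist connG v0 v) as [n hn]. exists n. now apply electrification_steps.
  - destruct (connected_vertex (connH c)) as [[v hv]].
    destruct (steps_exist connG v0 v) as [n hn]. exists (n + 1).
    apply (@steps_app (electrification G C H) n 1 (base v0) (base v) (cone c)).
    + now apply electrification_steps.
    + apply (@steps_cons (electrification G C H) 0 (base v) (cone c)).
      * now apply cone_adjacent.
      * constructor.
Qed.

Lemma dE_geodesic : geodesic_metric dE.
Proof. exact (vdist_geodesic electrification_connected). Qed.

Lemma dE_cone c v : dE (base v) (cone c) = 1 <-> H c v.
Proof.
  split; intros h.
  - apply cone_adjacent. exact (vdist_adjacent electrification_connected _ _ h).
  - apply cone_adjacent in h.
    pose proof (adjacent_vdist electrification_connected _ _ h) as l.
    destruct (Nat.eq_dec (dE (base v) (cone c)) 0) as [z|z].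
    + apply (gm_eq _ dE_geodesic) in z. discriminate.
    + fold dE in l. unfold dE in *. lia.
Qed.

Lemma dE_cones c c' : dE (cone c) (cone c') <> 1.
Proof.
  intros h. apply (vdist_adjacent electrification_connected) in h.
  destruct h as [[e|q] h]; simpl in h; destruct h as [[h1 h2]|[h1 h2]]; discriminate.
Qed.

Lemma dE_base_one u v : dE (base u) (base v) <= 1 -> dG u v <= 1.
Proof.
  intros h. destruct (Nat.eq_dec (dE (base u) (base v)) 0) as [z|z].
  - apply (gm_eq _ dE_geodesic) in z. injection z as ->.
    rewrite (gm_refl _ (vdist_geodesic connG)); lia.
  - apply (adjacent_vdist connG), electrification_adjacent.
    apply (vdist_adjacent electrification_connected). fold dE. unfold dE in *; lia.
Qed.

Lemma dE_le u v : dE (base u) (base v) <= dG u v.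
Proof.
  apply (vdist_min electrification_connected), electrification_steps, (vdist_steps connG).
Qed.

Lemma vdist_le_dH c (a b : member c) : dG (proj1_sig a) (proj1_sig b) <= dH c a b.
Proof.
  apply (vdist_min connG). pose proof (vdist_steps (connH c) a b) as s.
  revert s; unfold dH; generalize (@vdist (full_subgraph G (H c)) a b) as n.
  induction 1 as [v|n u v w h _ IH]; [constructor|].
  econstructor; [|exact IH]. destruct h as [[e q] h]; simpl in h. exists e.
  destruct h as [[<- <-]|[<- <-]]; simpl; auto.
Qed.

(** Indexed by the position before the cone point, so that no predecessor
    occurs. *)
Definition passage (n : nat) (g : nat -> vert G + C) (c : C) (i : nat) (a b : member c) : Prop :=
  S (S i) <= n /\ g i = base (proj1_sig a) /\ g (S i) = cone c /\
  g (S (S i)) = base (proj1_sig b).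

(** Bounded penetration for discrete paths.  Here a passage of [g'] has neighbours
    on both sides, so it lies in the interior of [g']. *)
Definition penetration_bound (p : nat) : Prop :=
  forall c n g i a b n' g',
    quasi_path (d := dE) n g -> quasi_path (d := dE) n' g' ->
    g 0 = g' 0 -> g n = g' n' -> passage n g c i a b -> p <= dH c a b ->
    (exists k, k <= n' /\ g' k = cone c) /\
    forall i' a' b', passage n' g' c i' a' b' -> dH c a a' <= p /\ dH c b b' <= p.

Lemma quasi_path_realization n g : quasi_path (d := dE) n g ->
  exists h, efficient_quasi_geodesic H 3 0 (Z.of_nat n) h /\
    realizes (G := electrification G C H) n g h.
Proof.
  intros q.
  destruct (@realization_exists (electrification G C H) n g) as [h r].
  { intros k hk. apply (vdist_adjacent electrification_connected).
    pose proof (q k (S k) ltac:(lia)) as l. unfold dE in l. lia. }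
  exists h; split; auto. split; [|split].
  - eapply realization_simplicial; eauto using electrification_connected.
  - intros c k k' hk hk' e e'.
    rewrite <- (Z2Nat.id k), <- INR_IZR_INZ in e by lia.
    rewrite <- (Z2Nat.id k'), <- INR_IZR_INZ in e' by lia.
    rewrite (rz_vertex _ _ _ r) in e, e' by lia.
    injection e as e. injection e' as e'.
    assert (Z.to_nat k = Z.to_nat k'); [|lia].
    apply (quasi_path_inj dE_geodesic n g); [exact q|lia|lia|].
    exact (eq_trans e (eq_sym e')).
  - eapply realization_quasi_geodesic; eauto using electrification_connected.
Qed.

Lemma penetration_bound_exists : bounded_penetration G C H -> exists p, penetration_bound p.
Proof.
  intros B. destruct (B 3%R ltac:(lra)) as [p0 [_ hp]]. clear B.
  destruct (INR_unbounded p0) as [p pp]. exists p.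
  intros c n g i a b n' g' q q' e0 en [hi [ga [gc gb]]] hab.
  destruct (quasi_path_realization n g q) as [h [eh r]].
  destruct (quasi_path_realization n' g' q') as [h' [eh' r']].
  assert (val : forall n g h, realizes (G := electrification G C H) n g h ->
    forall k z, k <= n -> z = Z.of_nat k -> h (IZR z) = pvert (g k)).
  { intros m f h0 r0 k z hk ->. rewrite <- INR_IZR_INZ. now apply (rz_vertex _ _ _ r0). }
  destruct (hp 0%Z (Z.of_nat n) h eh c (Z.of_nat (S i)) a b) with
    (a' := 0%Z) (b' := Z.of_nat n') (g' := h') as [h1 h2]; clear hp; auto; try lia.
  - rewrite (val _ _ _ r (S i)) by lia. now rewrite gc.
  - rewrite (val _ _ _ r i) by lia. now rewrite ga.
  - rewrite (val _ _ _ r (S (S i))) by lia. now rewrite gb.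
  - unfold sub_dist. rewrite (dist_vertex (connH c)). fold (dH c). apply le_INR in hab.
    unfold dH in hab. eapply Rle_trans; [apply Rlt_le, pp|exact hab].
  - rewrite (val _ _ _ r 0), (val _ _ _ r' 0) by lia. now rewrite e0.
  - rewrite (val _ _ _ r n), (val _ _ _ r' n') by lia. now rewrite en.
  - split.
    + destruct h1 as [t [ht hc]]. rewrite <- INR_IZR_INZ in ht.
      destruct (@realization_vertex_integral (electrification G C H) n' g' h' t _ r' ht hc)
        as [k [hk ->]].
      exists k; split; auto. rewrite (rz_vertex _ _ _ r') in hc by lia. now injection hc.
    + intros i' a' b' [hi' [ga' [gc' gb']]].
      destruct (h2 (Z.of_nat (S i')) a' b') as [d1 d2]; try lia.
      * rewrite (val _ _ _ r' (S i')) by lia. now rewrite gc'.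
      * rewrite (val _ _ _ r' i') by lia. now rewrite ga'.
      * rewrite (val _ _ _ r' (S (S i'))) by lia. now rewrite gb'.
      * unfold sub_dist in d1, d2. rewrite (dist_vertex (connH c)) in d1, d2.
        split; apply INR_le; unfold dH; lra.
Qed.

(** * Enlarged geodesics *)

Let MG : geodesic_metric dG := vdist_geodesic connG.
Let ME : geodesic_metric dE := dE_geodesic.
Let MH c : geodesic_metric (dH c) := dH_geodesic c.

(** The vertices on all enlargements of all geodesics of the electrification from
    [x] to [y]; as only distances occur, no path has to be chosen. *)
Definition enlarged (x y u : vert G) : Prop :=
  between dE (base x) (base u) (base y) \/
  exists c (a b v : member c),
    dE (base x) (base (proj1_sig a)) + 2 + dE (base (proj1_sig b)) (base y)
      = dE (base x) (base y) /\
    between (dH c) a v b /\ proj1_sig v = u.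

Lemma enlarged_sym x y u : enlarged x y u -> enlarged y x u.
Proof.
  intros [h|[c [a [b [v [h1 [h2 h3]]]]]]].
  - left; now apply (between_sym ME).
  - right; exists c, b, a, v.
    rewrite (gm_sym _ ME (base y) _), (gm_sym _ ME _ (base x)), (gm_sym _ ME (base y) (base x)).
    split; [lia|]. split; auto. now apply (between_sym (MH c)).
Qed.

Lemma quasi_path_step n g i : quasi_path (d := dE) n g -> i < n -> dE (g i) (g (S i)) = 1.
Proof. intros q hi. pose proof (q i (S i) ltac:(lia)). lia. Qed.

Lemma cone_passage n g c i : quasi_path (d := dE) n g -> 0 < i < n -> g i = cone c ->
  exists j a b, i = S j /\ passage n g c j a b.
Proof.
  intros q hi hc. destruct i as [|j]; [lia|].
  pose proof (quasi_path_step n g j q ltac:(lia)) as s1.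
  pose proof (quasi_path_step n g (S j) q ltac:(lia)) as s2.
  rewrite hc in s1, s2. rewrite (gm_sym _ ME) in s2.
  assert (N : forall w, dE w (cone c) = 1 -> exists a : member c, w = base (proj1_sig a)).
  { intros [v|c'] h.
    - apply dE_cone in h. now exists (exist _ v h).
    - now apply dE_cones in h. }
  destruct (N _ s1) as [a ha]. destruct (N _ s2) as [b hb].
  exists j, a, b; repeat split; auto; lia.
Qed.

Lemma geodesic_enlarged n a x y i u : geodesic_path dE n a ->
  a 0 = base x -> a n = base y -> i <= n -> a i = base u -> enlarged x y u.
Proof.
  intros g h0 hn hi hu. left. unfold between. rewrite <- h0, <- hn, <- hu.
  rewrite !g by lia; lia.
Qed.

Lemma geodesic_passage_enlarged n g x y c i a b v : geodesic_path dE n g ->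
  g 0 = base x -> g n = base y -> passage n g c i a b -> between (dH c) a v b ->
  enlarged x y (proj1_sig v).
Proof.
  intros gp h0 hn [hi [ha [hc hb]]] hv. right. exists c, a, b, v.
  rewrite <- h0, <- hn, <- ha, <- hb. rewrite !gp by lia. split; [lia|auto].
Qed.

Lemma passage_concat_l m l f g c i a b :
  passage m f c i a b -> passage (m + l) (concat m f g) c i a b.
Proof.
  intros [h1 [h2 [h3 h4]]]. unfold passage. rewrite !concat_l by lia.
  repeat split; auto; lia.
Qed.

Lemma passage_concat_r m l f g c i a b : f m = g 0 ->
  passage l g c i a b -> passage (m + l) (concat m f g) c (m + i) a b.
Proof.
  intros e [h1 [h2 [h3 h4]]]. unfold passage. rewrite <- !Nat.add_succ_r.
  rewrite !(concat_r m f g _ e). repeat split; auto; lia.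
Qed.

Lemma passage_junction m l f g c i (a b : member c) : f m = g 0 -> m = S i -> 1 <= l ->
  f i = base (proj1_sig a) -> f m = cone c -> g 1 = base (proj1_sig b) ->
  passage (m + l) (concat m f g) c i a b.
Proof.
  intros e -> hl ha hc hb. unfold passage.
  replace (S (S i)) with (S i + 1) by lia. rewrite (concat_r _ f g 1 e), !concat_l by lia.
  repeat split; auto; lia.
Qed.

Lemma passage_rev n m g c i a b : m <= n -> n <= m + i ->
  passage n g c i a b -> passage m (fun k => g (n - k)) c (n - S (S i)) b a.
Proof.
  intros hm hi [h1 [h2 [h3 h4]]]. unfold passage.
  replace (n - S (S (n - S (S i)))) with i by lia.
  replace (n - S (n - S (S i))) with (S i) by lia.
  replace (n - (n - S (S i))) with (S (S i)) by lia.
  repeat split; auto; lia.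
Qed.

(** In the graph, each ordinary edge of [t] costs 1, and the two edges of a passage
    can be replaced by a path of length at most [p] in [H c]. *)
Lemma shallow_path p l t u : quasi_path (d := dE) l t -> t l = base u ->
  (forall c i a b, passage l t c i a b -> dH c a b <= p) ->
  forall i w, i <= l -> t i = base w -> dG w u <= (l - i) * (p + 1).
Proof.
  intros q hu sh i w hi hw. remember (l - i) as k eqn:hk.
  revert i w hi hw hk; induction k as [k IH] using (well_founded_induction lt_wf).
  intros i w hi hw hk. destruct (Nat.eq_dec i l) as [->|ne].
  { rewrite hw in hu; injection hu as ->. rewrite (gm_refl _ MG); lia. }
  destruct (t (S i)) as [v|c] eqn:hv.
  - pose proof (quasi_path_step l t i q ltac:(lia)) as s. rewrite hw, hv in s.
    pose proof (dE_base_one w v ltac:(lia)).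
    pose proof (IH (k - 1) ltac:(lia) (S i) v ltac:(lia) hv ltac:(lia)).
    pose proof (gm_tri _ MG w v u).
    replace (k * (p + 1)) with ((k - 1) * (p + 1) + (p + 1)) by nia. lia.
  - assert (S i <> l) by (intros e; rewrite e, hu in hv; discriminate).
    destruct (cone_passage l t c (S i) q ltac:(lia) hv) as [j [a [b [e ps]]]].
    injection e as <-. pose proof (sh _ _ _ _ ps) as d.
    destruct ps as [h1 [h2 [h3 h4]]]. rewrite hw in h2; injection h2 as ->.
    pose proof (vdist_le_dH c a b).
    pose proof (IH (k - 2) ltac:(lia) (S (S i)) (proj1_sig b) ltac:(lia) h4 ltac:(lia)).
    pose proof (gm_tri _ MG (proj1_sig a) (proj1_sig b) u).
    replace (k * (p + 1)) with ((k - 2) * (p + 1) + 2 * (p + 1)) by nia. lia.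
Qed.

Context {KE KH p : nat}.
Context (FE : four_point KE dE).
Context (FH : forall c, four_point KH (dH c)).
Context (P : penetration_bound p).

(** By bounded penetration the part of [g] before [i] and the part after [i] would
    both visit [cone c].  As [g] is injective, this could happen only at [i], but
    [g i] is a vertex of the graph. *)
Lemma no_common_deep_passage n g i u m1 g1 m2 g2 :
  quasi_path (d := dE) n g -> i <= n -> g i = base u ->
  quasi_path (d := dE) m1 g1 -> g1 0 = g 0 -> g1 m1 = g i ->
  quasi_path (d := dE) m2 g2 -> g2 0 = g n -> g2 m2 = g i ->
  forall c i1 a1 b1 i2 a2 b2,
    passage m1 g1 c i1 a1 b1 -> passage m2 g2 c i2 a2 b2 ->
    p <= dH c a1 b1 -> p <= dH c a2 b2 -> False.
Proof.
  intros q hi hu q1 s1 e1 q2 s2 e2 c i1 a1 b1 i2 a2 b2 ps1 ps2 d1 d2.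
  pose proof (quasi_path_prefix n i g hi q) as qa.
  pose proof (quasi_path_rev ME n (n - i) g ltac:(lia) q) as qb.
  destruct (P c m1 g1 i1 a1 b1 i g q1 qa s1 e1 ps1 d1) as [[k1 [hk1 c1]] _].
  destruct (P c m2 g2 i2 a2 b2 (n - i) (fun k => g (n - k)) q2 qb) as [[k2 [hk2 c2]] _]; auto.
  - now rewrite Nat.sub_0_r.
  - now replace (n - (n - i)) with i by lia.
  - pose proof (quasi_path_inj ME n g k1 (n - k2) q ltac:(lia) ltac:(lia) ltac:(congruence)).
    replace k1 with i in c1 by lia. congruence.
Qed.

(** Join [u] by a shortest path [t] to a geodesic [a] from [x] to [z] passing within
    [r + KE] of [u].  Both halves of [a], continued by [t], are quasi-paths ending
    at [u], so a cone point on [t] is crossed shallowly.  If [t] starts at a cone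
    point [a j], the two continued halves cross it from the two neighbours of
    [a j] on [a], and one of these crossings is shallow. *)
Lemma quasi_vertex_near r x z n g i u :
  quasi_path (d := dE) n g -> g 0 = base x -> g n = base z -> i <= n -> g i = base u ->
  dE (base x) (base u) + dE (base u) (base z) <= dE (base x) (base z) + r ->
  exists u', enlarged x z u' /\ dG u u' <= (r + KE) * (p + 1).
Proof.
  intros q h0 hn hi hu hr.
  destruct (near_interval ME KE _ _ _ _ FE hr) as [v [hv hvu]].
  destruct (geodesic_path_exists ME (base x) v) as [a1 [ga1 [s1 e1]]].
  destruct (geodesic_path_exists ME v (base z)) as [a2 [ga2 [s2 e2]]].
  set (m := dE (base x) v + dE v (base z)).
  set (a := concat (dE (base x) v) a1 a2).
  assert (ga : geodesic_path dE m a).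
  { apply (geodesic_path_concat ME); auto; [congruence|]. now rewrite s1, e2. }
  assert (sa : a 0 = base x) by (unfold a; rewrite concat_l by lia; auto).
  assert (ea : a m = base z) by (unfold a, m; rewrite concat_r by congruence; auto).
  assert (va : a (dE (base x) v) = v) by (unfold a; rewrite concat_l by lia; auto).
  destruct (nearest_on_path (d := dE) m a (base u)) as [j [hj near]].
  pose proof (near (dE (base x) v) ltac:(unfold m; lia)) as nv. rewrite va in nv.
  rewrite (gm_sym _ ME v) in nv.
  destruct (geodesic_path_exists ME (a j) (base u)) as [t [gt [st et]]].
  set (l := dE (a j) (base u)) in *.
  assert (hl : l <= r + KE) by lia.
  assert (q1 : quasi_path (d := dE) (j + l) (concat j a t)).
  { apply (quasi_path_nearest ME); auto.
    - intros i1 i2 hi12; apply ga; lia.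
    - intros k hk. rewrite et. apply near; lia. }
  assert (q2 : quasi_path (d := dE) (m - j + l) (concat (m - j) (fun k => a (m - k)) t)).
  { apply (quasi_path_nearest ME); auto.
    - apply (geodesic_path_rev ME); auto; lia.
    - rewrite st; f_equal; lia.
    - intros k hk. rewrite et. apply near; lia. }
  assert (j2 : a (m - (m - j)) = t 0) by (rewrite st; f_equal; lia).
  (* of two passages through the same cone point, one on each continued half, at
     least one is shallow *)
  assert (sh : forall c i1 a1 b1 i2 a2 b2,
    passage (j + l) (concat j a t) c i1 a1 b1 ->
    passage (m - j + l) (concat (m - j) (fun k => a (m - k)) t) c i2 a2 b2 ->
    p <= dH c a1 b1 -> p <= dH c a2 b2 -> False).
  { apply (no_common_deep_passage n g i u); auto.
    - rewrite concat_l by lia. congruence.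
    - rewrite (concat_r j a t l) by auto. congruence.
    - rewrite concat_l, Nat.sub_0_r by lia. congruence.
    - rewrite (concat_r (m - j) (fun k => a (m - k)) t l) by auto. congruence. }
  assert (gl : forall w i1, i1 <= l -> t i1 = base w -> dG w u <= (l - i1) * (p + 1)).
  { intros w i1 hi1 hw. apply (shallow_path p l t u); auto.
    - now apply geodesic_path_quasi.
    - intros c k a' b' ps. destruct (le_lt_dec p (dH c a' b')); [exfalso|lia].
      eapply sh; eauto using passage_concat_r. }
  assert (fin : forall w, enlarged x z w -> dG w u <= l * (p + 1) ->
    exists u', enlarged x z u' /\ dG u u' <= (r + KE) * (p + 1)).
  { intros w hw hd. exists w; split; auto. rewrite (gm_sym _ MG).
    assert (l * (p + 1) <= (r + KE) * (p + 1)) by (apply Nat.mul_le_mono_r; auto). lia. }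
  destruct (a j) as [w|c] eqn:hw.
  - apply (fin w); [now apply (geodesic_enlarged m a x z j)|].
    pose proof (gl w 0 ltac:(lia) st). lia.
  - assert (j <> 0) by (intros e; rewrite e, sa in hw; discriminate).
    assert (j <> m) by (intros e; rewrite e, ea in hw; discriminate).
    destruct (cone_passage m a c j (geodesic_path_quasi m a ga) ltac:(lia) hw)
      as [k [b1 [b2 [-> ps]]]].
    assert (l <> 0) by (intros e; rewrite e, st in et; discriminate).
    pose proof (quasi_path_step l t 0 (geodesic_path_quasi l t gt) ltac:(lia)) as s.
    rewrite st, (gm_sym _ ME) in s.
    destruct (t 1) as [h|c'] eqn:ht; [|now apply dE_cones in s].
    apply dE_cone in s.
    pose proof (gl h 1 ltac:(lia) ht) as gh.
    pose proof (sh c k b1 (exist _ h s) (m - S (S k)) b2 (exist _ h s)) as sh'.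
    assert (hlp : l * (p + 1) = (l - 1) * (p + 1) + (p + 1)) by nia.
    pose proof ps as [p1 [p2 [p3 p4]]].
    assert (near_end : forall b : member c, enlarged x z (proj1_sig b) ->
      dH c b (exist _ h s) < p ->
      exists u', enlarged x z u' /\ dG u u' <= (r + KE) * (p + 1)).
    { intros b hb hd. apply (fin (proj1_sig b)); auto.
      pose proof (vdist_le_dH c b (exist _ h s)) as hd'. simpl in hd'.
      pose proof (gm_tri _ MG (proj1_sig b) h u). lia. }
    destruct (le_lt_dec p (dH c b1 (exist _ h s))) as [d1|d1];
      [destruct (le_lt_dec p (dH c b2 (exist _ h s))) as [d2|d2]|].
    + exfalso. apply sh'; auto.
      * apply passage_junction; auto; try lia. congruence.
      * apply passage_junction; auto; try lia.
        -- now replace (m - (m - S (S k))) with (S (S k)) by lia.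
        -- now replace (m - (m - S k)) with (S k) by lia.
    + apply (near_end b2); auto. apply (geodesic_enlarged m a x z (S (S k))); auto.
    + apply (near_end b1); auto. apply (geodesic_enlarged m a x z k); auto; lia.
Qed.

(** A shallow passage stays near its entry [a], which is handled by
    [quasi_vertex_near].  For a deep one, a geodesic from [x] to [z] has a passage
    through the same cone point with nearby ends, and the intervals of [H c]
    between the respective ends are close by hyperbolicity. *)
Lemma quasi_passage_near r x z n g c i a b v :
  quasi_path (d := dE) n g -> g 0 = base x -> g n = base z -> passage n g c i a b ->
  dE (base x) (g i) + dE (g i) (base z) <= dE (base x) (base z) + r ->
  between (dH c) a v b ->
  exists u', enlarged x z u' /\ dG (proj1_sig v) u' <= (r + KE) * (p + 1) + 4 * p + KH.
Proof.
  intros q h0 hn ps hr hv. pose proof ps as [p1 [p2 [p3 p4]]]. rewrite p2 in hr.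
  destruct (le_lt_dec p (dH c a b)) as [d|d].
  - destruct (geodesic_path_exists ME (base x) (base z)) as [f [gf [sf ef]]].
    set (m := dE (base x) (base z)) in *.
    pose proof (geodesic_path_quasi _ _ gf) as qf.
    destruct (P c n g i a b m f q qf ltac:(congruence) ltac:(congruence) ps d)
      as [[k [hk hc]] ends].
    assert (k <> 0) by (intros e; rewrite e, sf in hc; discriminate).
    assert (k <> m) by (intros e; rewrite e, ef in hc; discriminate).
    destruct (cone_passage m f c k qf ltac:(lia) hc) as [k' [a' [b' [-> ps']]]].
    destruct (ends k' a' b' ps') as [da db].
    unfold between in hv.
    pose proof (gm_tri _ (MH c) a' a v). pose proof (gm_sym _ (MH c) a' a).
    pose proof (gm_tri _ (MH c) v b b'). pose proof (gm_tri _ (MH c) a a' b).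
    pose proof (gm_tri _ (MH c) a' b' b). pose proof (gm_sym _ (MH c) b b').
    destruct (near_interval (MH c) KH a' v b' (4 * p) (FH c)) as [v' [h1 h2]]; [lia|].
    exists (proj1_sig v'). split.
    + eapply geodesic_passage_enlarged; eauto.
    + pose proof (vdist_le_dH c v v'). lia.
  - destruct (quasi_vertex_near r x z n g i (proj1_sig a)) as [u' [h1 h2]]; auto; [lia|].
    exists u'; split; auto. pose proof (vdist_le_dH c a v) as h3.
    rewrite (gm_sym _ MG) in h3. unfold between in hv.
    pose proof (gm_tri _ MG (proj1_sig v) (proj1_sig a) u'). lia.
Qed.

Let D1 := (2 * KE + 1 + KE) * (p + 1) + 4 * p + KH.

(** [a m] is a point of [a] nearest to [z], and [b] goes from there to [z]: one half
    of a triangle with vertices [x], [z] and a third one beyond [a m]. *)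
Section HalfTriangle.

Context (m l : nat) (a b : nat -> vert G + C) (x z : vert G).
Context (ga : geodesic_path dE m a) (gb : geodesic_path dE l b) (ab : a m = b 0).
Context (sa : a 0 = base x) (eb : b l = base z).
Context (near : forall i, i <= m -> l <= dE (a i) (base z)).

Let q : quasi_path (d := dE) (m + l) (concat m a b).
Proof. apply (quasi_path_nearest ME); auto. intros i hi; rewrite eb; auto. Qed.

Let start : concat m a b 0 = base x.
Proof. rewrite concat_l by lia; auto. Qed.

Let finish : concat m a b (m + l) = base z.
Proof. rewrite concat_r; auto. Qed.

Let almost_geodesic i : i <= m + l ->
  dE (base x) (concat m a b i) + dE (concat m a b i) (base z)
    <= dE (base x) (base z) + (2 * KE + 1).
Proof.
  intros hi. pose proof (q 0 i ltac:(lia)) as q1. pose proof (q i (m + l) ltac:(lia)) as q2.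
  rewrite start in q1. rewrite finish in q2.
  pose proof (gb 0 l ltac:(lia)) as hl. rewrite <- ab, eb in hl.
  pose proof (ga 0 m ltac:(lia)) as hm.
  assert (pr : dE (a 0) (a m) + dE (a m) (base z) <= dE (a 0) (base z) + 2 * KE + 1).
  { apply (geodesic_projection ME); auto. intros k hk. pose proof (near k hk). lia. }
  rewrite sa in pr, hm. lia.
Qed.

Lemma half_triangle_vertex i u : i <= m -> a i = base u ->
  exists u', enlarged x z u' /\ dG u u' <= D1.
Proof.
  intros hi hu.
  assert (hc : concat m a b i = base u) by (rewrite concat_l; auto).
  pose proof (almost_geodesic i ltac:(lia)) as h. rewrite hc in h.
  destruct (quasi_vertex_near (2 * KE + 1) x z (m + l) (concat m a b) i u)
    as [u' [h1 h2]]; auto; try lia.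
  exists u'; split; auto. unfold D1; lia.
Qed.

(** This includes the passage at [a m] when [a m] is a cone point. *)
Lemma half_triangle_passage c i e f v :
  passage (m + l) (concat m a b) c i e f -> between (dH c) e v f ->
  exists u', enlarged x z u' /\ dG (proj1_sig v) u' <= D1.
Proof.
  intros ps hv. apply (quasi_passage_near (2 * KE + 1) x z (m + l) (concat m a b) c i e f); auto.
  apply almost_geodesic. destruct ps; lia.
Qed.

End HalfTriangle.

Lemma geodesic_through_vertex x y u : between dE (base x) (base u) (base y) ->
  exists n g i, geodesic_path dE n g /\ g 0 = base x /\ g n = base y /\ i <= n /\ g i = base u.
Proof.
  intros h.
  destruct (geodesic_path_exists ME (base x) (base u)) as [a1 [ga1 [s1 e1]]].
  destruct (geodesic_path_exists ME (base u) (base y)) as [a2 [ga2 [s2 e2]]].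
  exists (dE (base x) (base u) + dE (base u) (base y)), (concat (dE (base x) (base u)) a1 a2),
    (dE (base x) (base u)).
  split; [|repeat split].
  - apply (geodesic_path_concat ME); auto; [congruence|]. now rewrite s1, e2.
  - now rewrite concat_l by lia.
  - now rewrite concat_r by congruence.
  - lia.
  - now rewrite concat_l by lia.
Qed.

Definition cone_path c (a b : member c) (i : nat) : vert G + C :=
  match i with 0 => base (proj1_sig a) | 1 => cone c | _ => base (proj1_sig b) end.

Lemma cone_path_passage c a b : passage 2 (cone_path c a b) c 0 a b.
Proof. repeat split; auto. Qed.

Lemma member_cone c (a : member c) : dE (base (proj1_sig a)) (cone c) = 1.
Proof. apply dE_cone. exact (proj2_sig a). Qed.

Lemma member_dist c (a b : member c) : dE (base (proj1_sig a)) (base (proj1_sig b)) <= 2.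
Proof.
  pose proof (gm_tri _ ME (base (proj1_sig a)) (cone c) (base (proj1_sig b))) as h.
  rewrite (gm_sym _ ME (cone c)), !member_cone in h. lia.
Qed.

Lemma cone_path_geodesic c a b : dE (base (proj1_sig a)) (base (proj1_sig b)) = 2 ->
  geodesic_path dE 2 (cone_path c a b).
Proof.
  intros h i j hij.
  destruct i as [|[|[|i]]]; destruct j as [|[|[|j]]]; try lia; simpl;
    rewrite ?(gm_refl _ ME), ?member_cone, ?(gm_sym _ ME (cone c)), ?member_cone; lia.
Qed.

Lemma geodesic_through_passage x y c a b :
  dE (base x) (base (proj1_sig a)) + 2 + dE (base (proj1_sig b)) (base y)
    = dE (base x) (base y) ->
  exists n g i, geodesic_path dE n g /\ g 0 = base x /\ g n = base y /\ passage n g c i a b.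
Proof.
  intros h.
  destruct (geodesic_path_exists ME (base x) (base (proj1_sig a))) as [a1 [ga1 [s1 e1]]].
  destruct (geodesic_path_exists ME (base (proj1_sig b)) (base y)) as [a2 [ga2 [s2 e2]]].
  set (m1 := dE (base x) (base (proj1_sig a))) in *.
  set (m2 := dE (base (proj1_sig b)) (base y)) in *.
  pose proof (member_dist c a b).
  pose proof (gm_tri _ ME (base x) (base (proj1_sig a)) (base y)).
  pose proof (gm_tri _ ME (base (proj1_sig a)) (base (proj1_sig b)) (base y)).
  assert (gt : geodesic_path dE (2 + m2) (concat 2 (cone_path c a b) a2)).
  { apply (geodesic_path_concat ME); auto.
    - apply cone_path_geodesic. lia.
    - rewrite e2. unfold cone_path. lia. }
  assert (et : concat 2 (cone_path c a b) a2 (2 + m2) = base y) by (rewrite concat_r; auto).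
  assert (st : concat 2 (cone_path c a b) a2 0 = base (proj1_sig a)).
  { now rewrite concat_l by lia. }
  exists (m1 + (2 + m2)), (concat m1 a1 (concat 2 (cone_path c a b) a2)), (m1 + 0).
  split; [|split; [|split]].
  - apply (geodesic_path_concat ME); auto. rewrite s1, et. lia.
  - now rewrite concat_l by lia.
  - rewrite concat_r by congruence. auto.
  - apply passage_concat_r; [congruence|]. apply passage_concat_l, cone_path_passage.
Qed.

(** Cut a geodesic from [x] to [y] at a vertex nearest to [z]; each half is covered
    by [half_triangle_vertex] and [half_triangle_passage].  Only a passage at the cut itself belongs to
    neither half; then the two halves continue to the same vertex of [H c], and
    the triangle spanned by it and the two ends of the passage is thin in
    [H c]. *)
Lemma enlarged_thin x y z u : enlarged x y u ->
  exists u', (enlarged x z u' \/ enlarged y z u') /\ dG u u' <= D1 + 2 * KH.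
Proof.
  assert (cut : forall n g, geodesic_path dE n g -> g 0 = base x -> g n = base y ->
    exists m l b, m <= n /\ geodesic_path dE l b /\ b 0 = g m /\ b l = base z /\
      (forall i, i <= n -> l <= dE (g i) (base z))).
  { intros n g gg s e. destruct (nearest_on_path (d := dE) n g (base z)) as [m [hm near]].
    destruct (geodesic_path_exists ME (g m) (base z)) as [b [gb [sb eb]]].
    exists m, (dE (g m) (base z)), b; auto 6. }
  intros [h|[c [a [b [v [h1 [h2 h3]]]]]]].
  - destruct (geodesic_through_vertex x y u h) as [n [g [i [gg [s [e [hi hu]]]]]]].
    destruct (cut n g gg s e) as [m [l [b [hm [gb [sb [eb near]]]]]]].
    destruct (le_lt_dec i m) as [im|im].
    + destruct (half_triangle_vertex m l g b x z) with (i := i) (u := u)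
        as [u' [k1 k2]]; auto.
      * intros i1 i2 hi12; apply gg; lia.
      * intros k hk; apply near; lia.
      * exists u'; split; [auto|lia].
    + destruct (half_triangle_vertex (n - m) l (fun k => g (n - k)) b y z)
        with (i := n - i) (u := u) as [u' [k1 k2]]; auto.
      * apply (geodesic_path_rev ME); auto; lia.
      * rewrite sb; f_equal; lia.
      * now rewrite Nat.sub_0_r.
      * intros k hk; apply near; lia.
      * lia.
      * rewrite <- hu; f_equal; lia.
      * exists u'; split; [auto|lia].
  - subst u. destruct (geodesic_through_passage x y c a b h1) as [n [g [i [gg [s [e ps]]]]]].
    destruct (cut n g gg s e) as [m [l [f [hm [gf [sf [ef near]]]]]]].
    assert (left_near : forall i a' b' v', passage (m + l) (concat m g f) c i a' b' ->
      between (dH c) a' v' b' ->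
      exists u', enlarged x z u' /\ dG (proj1_sig v') u' <= D1).
    { intros i' a' b' v' ps' hv'.
      apply (half_triangle_passage m l g f x z) with (c := c) (i := i') (e := a') (f := b'); auto.
      - intros i1 i2 hi12; apply gg; lia.
      - intros k hk; apply near; lia. }
    assert (j2 : g (n - (n - m)) = f 0) by (rewrite sf; f_equal; lia).
    assert (right_near : forall i a' b' v',
      passage (n - m + l) (concat (n - m) (fun k => g (n - k)) f) c i a' b' ->
      between (dH c) a' v' b' ->
      exists u', enlarged y z u' /\ dG (proj1_sig v') u' <= D1).
    { intros i' a' b' v' ps' hv'.
      apply (half_triangle_passage (n - m) l (fun k => g (n - k)) f y z)
        with (c := c) (i := i') (e := a') (f := b'); auto.
      - apply (geodesic_path_rev ME); auto; lia.
      - now rewrite Nat.sub_0_r.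
      - intros k hk; apply near; lia. }
    pose proof ps as [p1 [p2 [p3 p4]]].
    destruct (lt_eq_lt_dec (S i) m) as [[im|im]|im].
    + destruct (left_near i a b v) as [u' [k1 k2]]; auto.
      * apply passage_concat_l. repeat split; auto.
      * exists u'; split; [auto|lia].
    + assert (gc : g m = cone c) by congruence.
      assert (l <> 0) by (intros q; rewrite q, sf, gc in ef; discriminate).
      pose proof (quasi_path_step l f 0 (geodesic_path_quasi l f gf) ltac:(lia)) as st.
      rewrite sf, gc, (gm_sym _ ME) in st.
      destruct (f 1) as [w|c'] eqn:hf; [|now apply dE_cones in st].
      apply dE_cone in st.
      destruct (interval_triangle (MH c) KH a v b (exist _ w st) (FH c) h2) as [v' [d [k|k]]];
        pose proof (vdist_le_dH c v v') as dv.
      * destruct (left_near i a (exist _ w st) v') as [u' [k1 k2]]; auto.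
        { apply passage_junction; auto. lia. }
        exists u'; split; [auto|]. pose proof (gm_tri _ MG (proj1_sig v) (proj1_sig v') u'). lia.
      * destruct (right_near (n - S (S i)) b (exist _ w st) v') as [u' [k1 k2]]; auto.
        { apply passage_junction; auto; try lia.
          - now replace (n - (n - S (S i))) with (S (S i)) by lia.
          - now replace (n - (n - m)) with m by lia. }
        exists u'; split; [auto|]. pose proof (gm_tri _ MG (proj1_sig v) (proj1_sig v') u'). lia.
    + destruct (right_near (n - S (S i)) b a v) as [u' [k1 k2]]; auto.
      * apply passage_concat_l, passage_rev; auto; lia.
      * now apply (between_sym (MH c)).
      * exists u'; split; [auto|lia].
Qed.

Lemma enlarged_start x y : enlarged x y x.
Proof. left; unfold between. now rewrite (gm_refl _ ME). Qed.

Lemma enlarged_small x y u : dG x y <= 1 -> enlarged x y u -> dG x u <= 1.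
Proof.
  intros h. pose proof (dE_le x y).
  intros [k|[c [a [b [v [k _]]]]]]; [|lia].
  unfold between in k. apply dE_base_one. lia.
Qed.

Lemma chain_app (R : vert G -> Prop) x y z :
  chain (d := dG) R x y -> chain (d := dG) R y z -> chain (d := dG) R x z.
Proof. induction 1; auto. intros; econstructor; eauto. apply IHclos_refl_trans_1n; auto. Qed.

(** Stated inside a set [R] that contains the interval, since the links of a chain
    have to lie in the set. *)
Lemma interval_chain (R : vert G -> Prop) c (a b : member c) :
  (forall v, between (dH c) a v b -> R (proj1_sig v)) ->
  chain (d := dG) R (proj1_sig a) (proj1_sig b).
Proof.
  intros hR.
  cut (forall k v, between (dH c) a v b -> dH c v b = k ->
    chain (d := dG) R (proj1_sig v) (proj1_sig b)).
  { intros h; eapply h; eauto. unfold between. now rewrite (gm_refl _ (MH c)). }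
  induction k as [|k IH]; intros v hv hk.
  - apply (gm_eq _ (MH c)) in hk. subst; constructor.
  - destruct (gm_split _ (MH c) v b 1 ltac:(lia)) as [w [h1 h2]].
    assert (hw : between (dH c) a w b).
    { unfold between in *. pose proof (gm_tri _ (MH c) a v w).
      pose proof (gm_tri _ (MH c) a w b). lia. }
    econstructor; [|apply (IH w hw); lia].
    pose proof (vdist_le_dH c v w). repeat split; auto; lia.
Qed.

Lemma enlarged_chain x y : chain (d := dG) (enlarged x y) x y.
Proof.
  destruct (geodesic_path_exists ME (base x) (base y)) as [g [gg [s e]]].
  set (n := dE (base x) (base y)) in *. pose proof (geodesic_path_quasi n g gg) as q.
  cut (forall k i u, i + k = n -> g i = base u -> chain (d := dG) (enlarged x y) u y).
  { intros h. apply (h n 0); auto. }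
  induction k as [k IH] using (well_founded_induction lt_wf). intros i u hi hu.
  assert (ins : forall j w, j <= n -> g j = base w -> enlarged x y w).
  { intros j w hj hw. eapply geodesic_enlarged; eauto. }
  destruct k as [|k].
  { replace i with n in hu by lia. rewrite e in hu; injection hu as ->. constructor. }
  destruct (g (S i)) as [v|c] eqn:hv.
  - apply Relation_Operators.rt1n_trans with v.
    + split; [|split]; [apply (ins i); auto; lia|apply (ins (S i)); auto; lia|].
      apply dE_base_one. rewrite <- hu, <- hv, gg; lia.
    + apply (IH k ltac:(lia) (S i)); auto; lia.
  - assert (S i <> n) by (intros w; rewrite w, e in hv; discriminate).
    destruct (cone_passage n g c (S i) q ltac:(lia) hv) as [j [a [b [w ps]]]].
    injection w as <-. pose proof ps as [p1 [p2 [p3 p4]]].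
    rewrite hu in p2; injection p2 as ->.
    apply chain_app with (proj1_sig b).
    + apply interval_chain. intros v hv'. eapply geodesic_passage_enlarged; eauto.
    + apply (IH (k - 1) ltac:(lia) (S (S i))); auto; lia.
Qed.

Lemma enlarged_thin_family : thin_family (d := dG) (D1 + 2 * KH + 1) enlarged.
Proof.
  split.
  - apply enlarged_start.
  - apply enlarged_sym.
  - apply enlarged_chain.
  - intros x y u h hu. pose proof (enlarged_small x y u h hu). lia.
  - intros x y z u hu. destruct (enlarged_thin x y z u hu) as [u' [h1 h2]].
    exists u'; split; auto; lia.
Qed.

(** Members of [H c] are at distance at most 2 in the electrification.  So the
    only vertices of [enlarged x y] to worry about come from a passage from [x] to
    [y] through another cone point; it is shallow by bounded penetration, as the
    path through [cone c] avoids that cone point. *)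
Lemma enlarged_near_member c x y u : H c x -> H c y -> enlarged x y u ->
  exists v, H c v /\ dG u v <= p + 1.
Proof.
  intros hx hy hu.
  pose proof (member_dist c (exist _ x hx) (exist _ y hy)) as hd; simpl in hd.
  destruct hu as [h|[c' [a [b [v [h1 [h2 h3]]]]]]].
  - unfold between in h. destruct (le_lt_dec (dE (base x) (base u)) 1) as [l|l].
    + exists x; split; auto. rewrite (gm_sym _ MG).
      pose proof (dE_base_one _ _ l). lia.
    + exists y; split; auto.
      pose proof (dE_base_one u y ltac:(lia)). lia.
  - subst u.
    assert (ax : x = proj1_sig a).
    { assert (e : dE (base x) (base (proj1_sig a)) = 0) by lia.
      apply (gm_eq _ ME) in e. now injection e. }
    assert (yb : y = proj1_sig b).
    { assert (e : dE (base (proj1_sig b)) (base y) = 0) by lia.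
      apply (gm_eq _ ME) in e. now injection e. }
    subst x y. rewrite !(gm_refl _ ME) in h1.
    destruct (classic (c' = c)) as [->|ne].
    { exists (proj1_sig v); split; [exact (proj2_sig v)|]. rewrite (gm_refl _ MG); lia. }
    exists (proj1_sig a); split; auto.
    destruct (le_lt_dec p (dH c' a b)) as [d|d].
    + exfalso.
      pose proof (cone_path_geodesic c' a b ltac:(lia)) as g1.
      pose proof (cone_path_geodesic c (exist _ _ hx) (exist _ _ hy) ltac:(simpl; lia)) as g2.
      destruct (P c' 2 (cone_path c' a b) 0 a b 2 (cone_path c (exist _ _ hx) (exist _ _ hy)))
        as [[k [hk hc]] _]; auto using geodesic_path_quasi, cone_path_passage.
      destruct k as [|[|k]]; simpl in hc; try discriminate. injection hc as ->. auto.
    + pose proof (vdist_le_dH c' a v) as dv. rewrite (gm_sym _ MG) in dv.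
      unfold between in h2. lia.
Qed.

End Electrification.

(** * From thin families to the real metric graph *)

Local Open Scope R_scope.

(** A point on a real geodesic with ends in [Z] is near a vertex that is nearly
    between two vertices of [Z]; the product bound applies to it.  Replacing the
    three points by vertices at distance at most 1 costs the 4. *)
Lemma quasi_convex_of_family {G : graph} (connG : connected G) (Z : vert G -> Prop)
  (A : vert G -> vert G -> vert G -> Prop) K r :
  (forall w x y, exists q, A x y q /\
    (2 * vdist w q + vdist x y <= vdist x w + vdist w y + K)%nat) ->
  (forall x y u, Z x -> Z y -> A x y u -> exists v, Z v /\ (vdist u v <= r)%nat) ->
  quasi_convex (INR K / 2 + 4 + INR r) (subgraph_points Z).
Proof.
  intros hA hZ l g [hl hg] z0 zl t ht.
  assert (foot : forall x, subgraph_points Z x -> exists v, Z v /\ dist (pvert v) x <= 1).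
  { intros [v|e s hs] h; simpl in h.
    - exists v; split; auto. rewrite (dist_refl connG); lra.
    - exists (src e); split; [tauto|].
      apply Rle_trans with (Rabs (0 - s)).
      + apply (dist_le connG), (walk_edge e); constructor.
      + rewrite Rabs_left; lra. }
  destruct (foot _ z0) as [x [zx hx]]. destruct (foot _ zl) as [y [zy hy]].
  destruct (nearby_vertex connG (g t)) as [u hu].
  destruct (hA u x y) as [q [aq hq]]. destruct (hZ x y q zx zy aq) as [v [zv hv]].
  exists (pvert v). split; [exact zv|].
  pose proof (hg 0 t ltac:(lra) ht) as d1. pose proof (hg t l ht ltac:(lra)) as d2.
  pose proof (hg 0 l ltac:(lra) ltac:(lra)) as d3.
  rewrite Rabs_left1 in d1, d2, d3 by lra.
  apply le_INR in hq, hv. rewrite !plus_INR, mult_INR in hq.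
  rewrite <- !(dist_vertex connG) in hq. rewrite <- (dist_vertex connG) in hv.
  simpl in hq.
  pose proof (dist_tri connG (pvert x) (g 0) (pvert u)).
  pose proof (dist_tri connG (g 0) (g t) (pvert u)).
  pose proof (dist_tri connG (pvert u) (g t) (pvert y)).
  pose proof (dist_tri connG (g t) (g l) (pvert y)).
  pose proof (dist_tri connG (g 0) (pvert x) (g l)).
  pose proof (dist_tri connG (pvert x) (pvert y) (g l)).
  pose proof (dist_tri connG (g t) (pvert u) (pvert v)).
  pose proof (dist_tri connG (pvert u) (pvert q) (pvert v)).
  rewrite (dist_sym connG (g t) (pvert u)), (dist_sym connG (g 0) (pvert x)),
    (dist_sym connG (g l) (pvert y)) in *.
  lra.
Qed.

Theorem theorem1 :
  forall (G : graph) (C : Type) (H : C -> vert G -> Prop),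
    connected G ->
    (exists f : C -> nat, forall c c' : C, f c = f c' -> c = c') ->
    (forall c : C, connected (full_subgraph G (H c))) ->
    relatively_hyperbolic G C H ->
    (exists delta : R, (0 < delta)%R /\
       forall c : C, delta_hyperbolic delta (full_subgraph G (H c))) ->
    hyperbolic G /\
    (exists k : R, (0 < k)%R /\
       forall c : C, quasi_convex k (subgraph_points (H c))).
Proof.
  intros G C H connG _ connH [[dlE [_ hE]] B] [dlH [_ hH]].
  destruct (penetration_bound_exists H connG connH B) as [p P].
  destruct (INR_unbounded (2 * dlE)) as [KE hKE].
  destruct (INR_unbounded (2 * dlH)) as [KH hKH].
  pose proof (four_point_of_hyperbolic (electrification_connected H connG connH) KE dlE hE
    ltac:(lra)) as FE.
  assert (FH : forall c, four_point KH (dH H c)).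
  { intros c. apply (four_point_of_hyperbolic (connH c) KH dlH (hH c)). lra. }
  pose proof (enlarged_thin_family H connG connH FE FH P) as T.
  split.
  - destruct (thin_family_four_point (vdist_geodesic connG) T) as [K F].
    exact (hyperbolic_of_four_point connG K F).
  - destruct (family_product (vdist_geodesic connG) T) as [K hK].
    exists (INR K / 2 + 4 + INR (p + 1)). split.
    + pose proof (pos_INR K). pose proof (pos_INR (p + 1)). lra.
    + intros c. apply (quasi_convex_of_family connG (H c) (enlarged H)); auto.
      intros x y u. now apply enlarged_near_member.
Qed.
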